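(* Let $n,d,T_0\ge 1$ be integers, $\beta\ge 2$, $\alpha>0$, $L,\bar L>0$, $\sigma\ge 0$, $G,\mathcal K>0$. Let $\Theta\subset\mathbb R^d$ be a nonempty convex compact set with $\mathrm{diam}(\Theta)\le\mathcal K$. Let $f_1,\dots,f_n:\mathbb R^d\to\mathbb R$ belong to $\mathcal F_\beta(L)$ and be 2-smooth with constant $\bar L$, with $\max_{x\in\Theta}\|\nabla f_i(x)\|\le G$ for $1\le i\le n$, and suppose that $f=\frac1n\sum_{i=1}^n f_i$ is $\alpha$-strongly convex. Let $W\in\mathbb R^{n\times n}$ be symmetric and doubly stochastic with $\rho:=\|W-n^{-1}\mathbb 1\mathbb 1^\top\|_*<1$. Let $x^i(t)$ be the iterates of the distributed zero-order gradient algorithm (defined in the context) with the $2d$-query kernel gradient estimators, with a kernel $K$ and noise satisfying the conditions given in the context, and with parameters $\eta_t=\frac{2}{\alpha t}$ and $h_t=t^{-\frac1{2\beta}}$. Let $\bar x(t)=\frac1n\sum_{i=1}^n x^i(t)$. Then there are positive constants $\mathcal B_1,\mathcal B_2,\mathcal B_3$ independent of $T_0,d,\alpha,n,\rho$ such that for any $x\in\Theta$ the cumulative regret satisfies $$\sum_{t=1}^{T_0}\mathbb E\big[f(\bar x(t))-f(x)\big]\le \frac d\alpha T_0^{\frac1\beta}\Big(\mathcal B_1+\frac{\mathcal B_2\rho^2}{1-\rho}\Big)+\frac{\mathcal B_3}{\alpha(1-\rho)}(\log(T_0)+1).$$ Furthermore, if $x^*$ is the minimizer of $f$ over $\Theta$,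 the averaged estimator $\hat x(T_0)=\frac1{T_0}\sum_{t=1}^{T_0}\bar x(t)$ satisfies $$\mathbb E[f(\hat x(T_0))-f(x^* )]\le \frac d\alpha T_0^{-\frac{\beta-1}\beta}\Big(\mathcal B_1+\frac{\mathcal B_2\rho^2}{1-\rho}\Big)+\frac{\mathcal B_3}{\alpha(1-\rho)}\Big(\frac{\log(T_0)+1}{T_0}\Big).$$
   Context: Notation. $\|\cdot\|$ is the Euclidean norm, $\|\cdot\|_*$ the spectral norm of a matrix, $\mathbb 1\in\mathbb R^n$ the all-ones vector, $e_j$ the $j$-th canonical basis vector of $\mathbb R^d$, $\mathrm{Proj}_\Theta$ the Euclidean projection onto $\Theta$, $\mathrm{diam}$ the Euclidean diameter, $U[-1,1]$ the uniform distribution on $[-1,1]$. $\lfloor x\rfloor$ denotes the maximal integer (strictly) less than $x$, and $\ell=\lfloor\beta\rfloor$. Function classes. $\mathcal F_\beta(L)$ is the set of functions $F:\mathbb R^d\to\mathbb R$ that are $\ell$ times differentiable and satisfy $\big|F(z)-\sum_{0\le|m|\le\ell}\frac1{m!}D^mF(x)(z-x)^m\big|\le L\|z-x\|^\beta$ for all $x,z\in\mathbb R^d$ (sum over multi-indices $m\in\mathbb N^d$, usual multi-index notation). $F$ is 2-smooth with constant $\bar L$ if it is differentiable and $\|\nabla F(x)-\nabla F(x')\|\le\bar L\|x-x'\|$ for all $x,x'\in\mathbb R^d$. $F$ is $\alpha$-strongly convex if it is differentiable on $\mathbb R^d$ and $F(x)-F(x')\ge\langle\nabla F(x'),x-x'\rangle+\frac\alpha2\|x-x'\|^2$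 for all $x,x'\in\mathbb R^d$. Kernel. $K:[-1,1]\to\mathbb R$ satisfies, for $r\sim U[-1,1]$: $\mathbb E[rK(r)]=1$, $\mathbb E[r^jK(r)]=0$ for $j\in\{0\}\cup\{2,3,\dots,\ell\}$, $\kappa_\beta:=\mathbb E[|r|^\beta|K(r)|]<\infty$, and $\kappa:=\mathbb E[K^2(r)]<\infty$. Algorithm. Start from $x^1(1)=\dots=x^n(1)\in\Theta$. At each step $t=1,2,\dots$, each agent $i$ draws $r_i(t)\sim U[-1,1]$, observes for $j=1,\dots,d$ the values $y_{i,j}(t)=f_i(x^i(t)+h_tr_i(t)e_j)+\xi_{i,j}(t)$ and $y'_{i,j}(t)=f_i(x^i(t)-h_tr_i(t)e_j)+\xi'_{i,j}(t)$, and forms $g^i(t)\in\mathbb R^d$ with $j$-th coordinate $\frac1{2h_t}(y_{i,j}(t)-y'_{i,j}(t))K(r_i(t))$. Then $x^i(t+1)=\sum_{k=1}^nW_{ik}\,\mathrm{Proj}_\Theta\big(x^k(t)-\eta_tg^k(t)\big)$, $i=1,\dots,n$. Noise assumption. Let $\mathcal F_t$ be the $\sigma$-algebra generated by $x^1(t),\dots,x^n(t)$. For all $t$ and $i$: (i) $r_i(t)\sim U[-1,1]$ is independent of $\xi_{i,1}(t),\dots,\xi_{i,d}(t),\xi'_{i,1}(t),\dots,\xi'_{i,d}(t)$ and of $\mathcal F_t$; (ii) $\mathbb E[(\xi_{i,j}(t))^2]\le\sigma^2$ and $\mathbb E[(\xi'_{i,j}(t))^2]\le\sigma^2$ for $j=1,\dots,d$.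 The noises need not have zero mean nor be independent of each other. Constants: ''independent of $T_0,d,\alpha,n,\rho$'' means that the constants may depend only on the remaining parameters $\beta,L,\bar L,\sigma,G,\mathcal K$ and the kernel $K$. *)

(* Defs.v *)
From HB Require Import structures.
From mathcomp Require Import all_boot all_order all_algebra.
From mathcomp Require Import all_classical all_reals all_analysis.
Set Implicit Arguments.
Unset Strict Implicit.
Unset Printing Implicit Defensive.
Import Order.TTheory GRing.Theory Num.Theory.
Import numFieldNormedType.Exports.
Local Open Scope classical_set_scope.
Local Open Scope ring_scope.

(* Vectors of R^d are row vectors.  The library norm `|v| on 'rV[R]_d is the
   sup norm (same topology and same differentiability notion), hence [enorm]. *)
Section Euclidean.
Context {R : realType}.

Definition dotv d (u v : 'rV[R]_d) : R := \sum_(i < d) u 0 i * v 0 i.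

Definition enorm d (v : 'rV[R]_d) : R := Num.sqrt (dotv v v).

Definition basis_vec d (j : 'I_d) : 'rV[R]_d := delta_mx 0 j.

Definition ediam d (A : set 'rV[R]_d) : \bar R :=
  ereal_sup [set (enorm (p.1 - p.2))%:E | p in A `*` A].

(* Well defined (and independent of the default value 0) when A is nonempty,
   closed and convex. *)
Definition eproj d (A : set 'rV[R]_d) (u : 'rV[R]_d) : 'rV[R]_d :=
  xget 0 [set y | A y /\ forall z, A z -> enorm (u - y) <= enorm (u - z)].

(* v *m A^T is A applied to v seen as a column vector. *)
Definition spectral_norm n (A : 'M[R]_n) : R :=
  sup [set enorm (v *m A^T) | v in [set v : 'rV[R]_n | enorm v <= 1]].

Definition doubly_stochastic n (W : 'M[R]_n) : Prop :=
  [/\ forall i j, 0 <= W i j,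
      forall i, \sum_j W i j = 1 &
      forall j, \sum_i W i j = 1].

End Euclidean.

Section FunctionClasses.
Context {R : realType} {d : nat}.
Implicit Types (F : 'rV[R]_d -> R) (x z v : 'rV[R]_d).

Definition pderiv (i : 'I_d) F : 'rV[R]_d -> R :=
  fun x => 'D_(basis_vec i) F x.

Definition gradient F x : 'rV[R]_d := \row_i pderiv i F x.

(* A function is k+1 times (Frechet) differentiable iff it is differentiable
   and all its partial derivatives are k times differentiable. *)
Fixpoint times_differentiable (k : nat) F : Prop :=
  if k is k'.+1 then
    (forall x, differentiable F x) /\
    (forall i, times_differentiable k' (pderiv i F))
  else True.

(* Multi-indices with |m| <= l have all entries <= l, so they are encoded as
   functions 'I_d -> 'I_l.+1. *)
Definition mdeg l (m : {ffun 'I_d -> 'I_l.+1}) : nat := (\sum_i m i)%N.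

Definition mfact l (m : {ffun 'I_d -> 'I_l.+1}) : nat := (\prod_i (m i)`!)%N.

Definition mpow l (v : 'rV[R]_d) (m : {ffun 'I_d -> 'I_l.+1}) : R :=
  \prod_i v 0 i ^+ m i.

Definition mderiv l (m : {ffun 'I_d -> 'I_l.+1}) F : 'rV[R]_d -> R :=
  foldr (fun i G => iter (m i) (pderiv i) G) F (enum 'I_d).

Definition taylor l F x z : R :=
  \sum_(m : {ffun 'I_d -> 'I_l.+1} | (mdeg m <= l)%N)
    (mfact m)%:R^-1 * mderiv m F x * mpow (z - x) m.

(* The maximal integer strictly less than beta, for beta > 0. *)
Definition strict_floor (beta : R) : nat := `|Num.ceil beta - 1|%N.

Definition holder_class (beta L : R) F : Prop :=
  let l := strict_floor beta in
  times_differentiable l F /\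
  forall x z, `|F z - taylor l F x z| <= L * enorm (z - x) `^ beta.

Definition two_smooth (Lbar : R) F : Prop :=
  (forall x, differentiable F x) /\
  forall x x', enorm (gradient F x - gradient F x') <= Lbar * enorm (x - x').

Definition strongly_convex (alpha : R) F : Prop :=
  (forall x, differentiable F x) /\
  forall x x', F x - F x' >=
    dotv (gradient F x') (x - x') + alpha / 2 * enorm (x - x') ^+ 2.

End FunctionClasses.

Lemma strict_floorP (R : realType) (beta : R) : 0 < beta ->
  (strict_floor beta)%:R < beta <= (strict_floor beta).+1%:R.
Proof.
move=> b0; have c0 : 0 <= Num.ceil beta - 1.
  by rewrite subr_ge0 -gtz0_ge1 -(ltr_int R) (lt_le_trans b0)// ceil_ge.
have -> : (strict_floor beta).+1%:R = (Num.ceil beta)%:~R :> R.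
  by rewrite -[_.+1]addn1 natrD pmulrn /strict_floor gez0_abs// intrB subrK.
by rewrite pmulrn /strict_floor gez0_abs// ceil_itv.
Qed.

Section Kernel.
Context {R : realType}.

Let ltN11 : (-1 : R) < 1. Proof. by rewrite gtrN. Qed.

Definition uniformN11 : probability (measurableTypeR R) R := uniform_prob ltN11.

(* A kernel on [-1, 1] is represented by a measurable extension to R; its values
   outside [-1, 1] are irrelevant since uniformN11 does not charge them. *)
Definition kernel_cond (beta : R) (K : R -> R) : Prop :=
  [/\ measurable_fun [set: R] K,
      ('E_uniformN11[fun r => (r * K r)%R] = 1)%E,
      (forall j : nat, (j == 0)%N || (2 <= j <= strict_floor beta)%N ->
         ('E_uniformN11[fun r => (r ^+ j * K r)%R] = 0)%E),
      ('E_uniformN11[fun r => (`|r| `^ beta * `|K r|)%R] < +oo)%E &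
      ('E_uniformN11[fun r => (K r ^+ 2)%R] < +oo)%E].

End Kernel.

Section Process.
Context {R : realType} {disp : measure_display} {T : measurableType disp}.
Context (P : probability T R) {n d : nat}.

Definition sigma_generated (I : Type) (X : I -> T -> R) : set (set T) :=
  <<s \bigcup_(i in [set: I]) preimage_set_system setT (X i) measurable >>.

Definition independent_of (X : T -> R) (S : set (set T)) : Prop :=
  forall (B : set R) (A : set T), measurable B -> S A ->
    (P (X @^-1` B `&` A) = P (X @^-1` B) * P A)%E.

(* The sigma-algebra on R^d is generated by the coordinates. *)
Definition state_algebra (x : 'I_n -> nat -> T -> 'rV[R]_d) (t : nat) :
    set (set T) :=
  sigma_generated (fun (ik : 'I_n * 'I_d) w => x ik.1 t w 0 ik.2).

Definition noise_algebra (xi xi' : 'I_n -> nat -> 'I_d -> T -> R)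
    (i : 'I_n) (t : nat) : set (set T) :=
  sigma_generated (fun jb : 'I_d * bool => (if jb.2 then xi else xi') i t jb.1).

(* r_i(t) is independent of the pair (noises of agent i at time t, F_t), i.e. of
   the sigma-algebra they jointly generate.  Distributions are compared on
   measurable sets only, as measures are unspecified elsewhere. *)
Definition noise_cond (sigma : R) (r : 'I_n -> nat -> {RV P >-> R})
    (xi xi' : 'I_n -> nat -> 'I_d -> {RV P >-> R})
    (x : 'I_n -> nat -> T -> 'rV[R]_d) : Prop :=
  forall (i : 'I_n) (t : nat), (1 <= t)%N ->
  [/\ forall B : set R, measurable B -> distribution P (r i t) B = uniformN11 B,
      independent_of (r i t)
        <<s noise_algebra (fun i t j => xi i t j) (fun i t j => xi' i t j) i t
            `|` state_algebra x t >>,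
      forall j, ('E_P[fun w => (xi i t j w ^+ 2)%R] <= (sigma ^+ 2)%:E)%E &
      forall j, ('E_P[fun w => (xi' i t j w ^+ 2)%R] <= (sigma ^+ 2)%:E)%E].

Definition grad_estimator (K : R -> R) (f : 'rV[R]_d -> R) (h : R)
    (x : 'rV[R]_d) (r : R) (xi xi' : 'I_d -> R) : 'rV[R]_d :=
  \row_j (let y := f (x + (h * r) *: basis_vec j) + xi j in
          let y' := f (x - (h * r) *: basis_vec j) + xi' j in
          (2 * h)^-1 * (y - y') * K r).

(* Time starts at 1; x i 0 is unconstrained and never used. *)
Definition zero_order_iterates (Theta : set 'rV[R]_d)
    (f : 'I_n -> 'rV[R]_d -> R) (W : 'M[R]_n) (K : R -> R) (eta h : nat -> R)
    (r : 'I_n -> nat -> T -> R) (xi xi' : 'I_n -> nat -> 'I_d -> T -> R)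
    (x : 'I_n -> nat -> T -> 'rV[R]_d) : Prop :=
  (exists2 x1, Theta x1 & forall i w, x i 1%N w = x1) /\
  forall (t : nat) i w, (1 <= t)%N ->
    let g k := grad_estimator K (f k) (h t) (x k t w) (r k t w)
                 (fun j => xi k t j w) (fun j => xi' k t j w) in
    x i t.+1 w = \sum_(k < n) W i k *: eproj Theta (x k t w - eta t *: g k).

Definition mean_fun (f : 'I_n -> 'rV[R]_d -> R) : 'rV[R]_d -> R :=
  fun z => n%:R^-1 * \sum_(i < n) f i z.

Definition mean_iterate (x : 'I_n -> nat -> T -> 'rV[R]_d) (t : nat) (w : T) :
    'rV[R]_d :=
  n%:R^-1 *: \sum_(i < n) x i t w.

Definition averaged_estimator (x : 'I_n -> nat -> T -> 'rV[R]_d) (T0 : nat)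
    (w : T) : 'rV[R]_d :=
  T0%:R^-1 *: \sum_(1 <= t < T0.+1) mean_iterate x t w.

End Process.

(* Main.v *)
Require Import Defs.
From HB Require Import structures.
From mathcomp Require Import all_boot all_order all_algebra.
From mathcomp Require Import all_classical all_reals all_analysis measurable_realfun.
From mathcomp Require Import lra ring.
Import Order.TTheory GRing.Theory Num.Theory.
Import numFieldNormedType.Exports.
Local Open Scope classical_set_scope.
Local Open Scope ring_scope.

Set Implicit Arguments.
Unset Strict Implicit.
Unset Printing Implicit Defensive.

(** Let A_t be the average over the agents of E |x^i(t) - x|^2 and delta_t the
    root mean square distance of the agents to their mean.  Since projections
    are nonexpansive and W is doubly stochastic,
      2 eta_t avg E <g^i, x^i - x> <= A_t - A_(t+1) + eta_t^2 avg E |g^i|^2,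
    and with eta_t = 2 / (alpha t) strong convexity turns this into the
    telescoping (alpha / 4) ((t - 1) A_t - t A_(t+1)), up to the bias of g^i and
    an error linear in delta_t.

    The consensus error is bounded pathwise: W contracts deviations from the
    mean by rho, so delta_(t+1) <= rho (delta_t + eta_t |g|), and
    2 rho |g| <= rho^2 |g|^2 + 1 yields
      sum_t E delta_t <= (1 - rho)^-1 sum_t (rho^2 E |g|^2 + 1) / (alpha t),
    whose two parts are the terms in rho^2 / (1 - rho) and in log T_0 of the bound.

    Expand f_i(x +- h r e_j) by Taylor along e_j.  As r is independent of the
    noise and of the past, E K = 0 removes the noise however it is distributed,
    and the moment conditions on K leave only the first partial derivative: the
    bias of each coordinate is at most L kappa_beta h^(beta-1), and
    E |g|^2 = O(d / h^2).  For h_t = t^(-1/(2 beta)), the squared bias over alpha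
    and eta_t E |g|^2 are both of order (d / alpha) t^(1/beta - 1). *)

(** * Integration of real functions and independence *)

(** Strong convexity contributes [- alpha / 2 * A_t]. Half of it pays for the bias: Young's
    inequality turns bias times distance into [alpha / 4 * A_t] plus the squared bias over [alpha].
    The remaining [- alpha / 4 * A_t] lowers the weight of A_t from [t] to [t - 1]; this weight
    vanishes at [t = 1], so the initial distance never enters the bound. Only the average f is
    convex, so convexity is applied at the mean of the agents and each gradient is then moved to its
    own agent, which produces the term linear in delta_t. Two obstacles shape the rest. Independence
    is available agent by agent, between r_i(t) and the sigma-algebra generated by the noise of
    agent i and the states at time t; every expectation involving r is therefore brought to one
    product rule, a factor measurable for that sigma-algebra times a function of r. And
    differentiability of order [l] yields continuity of derivatives only below order [l], while the
    Taylor terms can be integrated one by one only if all of them, the top one included, are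
    measurable and bounded on Theta. *)

Section integrability.
Context {R : realType} {disp : measure_display} {T : measurableType disp}.
Variable P : probability T R.

Definition intg (X : T -> R) := P.-integrable [set: T] (EFin \o X).

(** [Rintegral] takes the finite part of the integral, so the value is meaningful only next to
    [intg X]; integrability is carried along with every estimate. *)
Definition mean (X : T -> R) : R := \int[P]_w X w.

Lemma intg_measurable X : intg X -> measurable_fun [set: T] X.
Proof. by move=> /(measurable_int P)/measurable_EFinP. Qed.

Lemma expectation_mean X : intg X -> ('E_P[X] = (mean X)%:E)%E.
Proof. by move=> iX; rewrite unlock /mean /Rintegral fineK// integrable_fin_num. Qed.

Lemma intg_dom (X Y : T -> R) : measurable_fun [set: T] X -> intg Y ->
  (forall w, `|X w| <= Y w) -> intg X.
Proof.
move=> mX iY XY; apply: (le_integrable measurableT _ _ iY).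
  exact/measurable_EFinP.
by move=> w _ /=; rewrite lee_fin (le_trans (XY w))// ler_norm.
Qed.

Lemma intg_cst c : intg (fun=> c).
Proof. exact: finite_measure_integrable_cst. Qed.

Lemma intg_bounded (X : T -> R) M : measurable_fun [set: T] X ->
  (forall w, `|X w| <= M) -> intg X.
Proof. by move=> mX XM; exact: (intg_dom mX (intg_cst M)). Qed.

Lemma intgD (X Y : T -> R) : intg X -> intg Y -> intg (fun w => X w + Y w).
Proof.
move=> iX iY; have := integrableD measurableT iX iY.
by apply: eq_integrable.
Qed.

Lemma intgZ c (X : T -> R) : intg X -> intg (fun w => c * X w).
Proof.
move=> iX; have := integrableZl measurableT c iX.
by apply: eq_integrable.
Qed.

Lemma intgB (X Y : T -> R) : intg X -> intg Y -> intg (fun w => X w - Y w).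
Proof.
move=> iX iY; have := integrableB measurableT iX iY.
by apply: eq_integrable.
Qed.

Lemma intg_sum I (s : seq I) (Q : pred I) (X : I -> T -> R) :
  (forall i, Q i -> intg (X i)) -> intg (fun w => \sum_(i <- s | Q i) X i w).
Proof.
move=> iX; elim: s => [|i s IH].
  by have := intg_cst 0; apply: eq_integrable => // w _; rewrite /= big_nil.
have [Qi|Qi] := boolP (Q i).
  have := intgD (iX i Qi) IH.
  by apply: eq_integrable => // w _; rewrite /= big_cons Qi.
by move: IH; apply: eq_integrable => // w _; rewrite /= big_cons (negbTE Qi).
Qed.

Lemma intg_norm (X : T -> R) : intg X -> intg (fun w => `|X w|).
Proof. by move=> iX; exact: (integrable_norm iX). Qed.

Lemma meanD (X Y : T -> R) : intg X -> intg Y ->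
  mean (fun w => X w + Y w) = mean X + mean Y.
Proof. by move=> iX iY; rewrite /mean RintegralD. Qed.

Lemma meanB (X Y : T -> R) : intg X -> intg Y ->
  mean (fun w => X w - Y w) = mean X - mean Y.
Proof. by move=> iX iY; rewrite /mean RintegralB. Qed.

Lemma meanZ c (X : T -> R) : intg X -> mean (fun w => c * X w) = c * mean X.
Proof. by move=> iX; rewrite /mean RintegralZl. Qed.

Lemma mean_cst c : mean (fun=> c) = c.
Proof.
by rewrite /mean Rintegral_cst// (_ : fine _ = 1) ?mulr1//= probability_setT.
Qed.

Lemma mean_sum I (s : seq I) (Q : pred I) (X : I -> T -> R) :
  (forall i, Q i -> intg (X i)) ->
  mean (fun w => \sum_(i <- s | Q i) X i w) = \sum_(i <- s | Q i) mean (X i).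
Proof.
move=> iX; elim: s => [|i s IH].
  rewrite big_nil -[RHS](mean_cst 0); congr mean.
  by apply/funext => w; rewrite big_nil.
rewrite big_cons; have [Qi|Qi] := boolP (Q i).
  rewrite -IH -meanD//; last 2 first.
  - exact: iX.
  - exact: intg_sum.
  by congr mean; apply/funext => w; rewrite big_cons Qi.
by rewrite -IH; congr mean; apply/funext => w; rewrite big_cons (negbTE Qi).
Qed.

Lemma le_mean (X Y : T -> R) : intg X -> intg Y -> (forall w, X w <= Y w) ->
  mean X <= mean Y.
Proof. by move=> iX iY XY; apply: le_Rintegral. Qed.

Lemma mean_ge0 (X : T -> R) : (forall w, 0 <= X w) -> 0 <= mean X.
Proof. by move=> X0; apply: Rintegral_ge0. Qed.

(** Exceptional null sets arise because [r] lies in [-1, 1] only almost surely, while the extension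
    of [K] outside [-1, 1] is arbitrary. *)
Lemma intg_ae_dom (X Y : T -> R) (N : set T) : measurable N -> P N = 0%E ->
  measurable_fun [set: T] X -> intg Y -> (forall w, ~ N w -> `|X w| <= Y w) ->
  intg X.
Proof.
move=> mN PN mX iY XY.
have mEX : measurable_fun [set: T] (EFin \o X) by exact/measurable_EFinP.
apply: (negligible_integrable mN measurableT mEX PN).2.
apply: (le_integrable _ _ _ (integrableS measurableT _ _ iY)) => //.
- exact: measurableD.
- exact: measurable_funTS.
- by move=> w [_ Nw] /=; rewrite lee_fin (le_trans (XY w Nw))// ler_norm.
- exact: measurableD.
Qed.

Lemma le_mean_ae (X Y : T -> R) (N : set T) : measurable N -> P N = 0%E ->
  intg X -> intg Y -> (forall w, ~ N w -> X w <= Y w) -> mean X <= mean Y.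
Proof.
move=> mN PN iX iY XY; rewrite /mean /Rintegral.
rewrite (negligible_integral mN measurableT iX PN).
rewrite (negligible_integral mN measurableT iY PN).
have mTN : measurable ([set: T] `\` N) by exact: measurableD.
apply: le_Rintegral => //.
- exact: (integrableS measurableT).
- exact: (integrableS measurableT).
- by move=> w [_ Nw]; exact: XY.
Qed.

End integrability.

Section independence.
Context {R : realType} {disp : measure_display} {T : measurableType disp}.
Variable P : probability T R.

(** The law of [(Y, Z)] and the product of the two laws agree on rectangles, hence everywhere;
    Fubini on the product then separates the factors. *)
Lemma mean_mul_independent (Y Z : T -> R) :
  (forall A B : set R, measurable A -> measurable B ->
     P (Y @^-1` A `&` Z @^-1` B) = (P (Y @^-1` A) * P (Z @^-1` B))%E) ->
  intg P Y -> intg P Z ->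
  intg P (fun w => Y w * Z w) /\
  mean P (fun w => Y w * Z w) = mean P Y * mean P Z.
Proof.
move=> indep iY iZ.
have mY := intg_measurable iY; have mZ := intg_measurable iZ.
pose Y' : {RV P >-> R} := HB.pack Y (isMeasurableFun.Build _ _ _ _ Y mY).
pose Z' : {RV P >-> R} := HB.pack Z (isMeasurableFun.Build _ _ _ _ Z mZ).
pose YZ w := (Y w, Z w).
have mYZ : measurable_fun [set: T] YZ by exact: measurable_fun_pair.
pose V : {mfun T >-> (R * R)%type} := HB.pack YZ (isMeasurableFun.Build _ _ _ _ YZ mYZ).
pose m1 := distribution P Y'; pose m2 := distribution P Z'.
pose m := distribution P V.
have mE X : measurable X -> (m1 \x m2)%E X = m X.
  apply: product_measure_unique => A B mA mB.
  exact: indep.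
have mmul : measurable_fun [set: R * R] (fun z : R * R => z.1 * z.2).
  by apply: measurable_funM.
pose f (z : R * R) := (z.1 * z.2)%:E.
have mf : measurable_fun [set: R * R] f by exact/measurable_EFinP.
have cst_fin (U : T -> R) : intg P U -> (\int[P]_w `|(U w)%:E| < +oo)%E.
  by move=> /integrableP[].
have mfx (x : R) : measurable_fun [set: R] (fun y => f (x, y)).
  by apply/measurable_EFinP; exact: (@mulrl_measurable _ _ x).
have int1 (x : R) : (\int[m2]_y `|f (x, y)| = `|x|%:E * \int[P]_w `|(Z w)%:E|)%E.
  rewrite (ge0_integral_distribution Z')//=; last first.
    by apply/measurable_EFinP/measurableT_comp => //; exact: mulrl_measurable.
  under eq_integral do rewrite /f /= normrM EFinM.
  rewrite ge0_integralZl//=.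
  by apply/measurable_EFinP; exact: measurableT_comp.
(* By Tonelli: the inner integral of [|x * y|] is [|x|] times the finite absolute mean of [Z]. *)
have im : (m1 \x m2)%E.-integrable [set: R * R] f.
  apply/integrable12ltyP => //.
  under eq_integral do rewrite int1.
  rewrite ge0_integralZr//; last exact: integral_ge0.
    rewrite (ge0_integral_distribution Y')//=.
      by rewrite lte_mul_pinfty ?integral_ge0 ?ge0_fin_numE ?integral_ge0//; exact: cst_fin.
    exact/measurable_EFinP.
  exact: (measurableT_comp (@abse_measurable _ _) (@EFin_measurable _ _)).
have iYZ : P.-integrable [set: T] (f \o V).
  apply/integrableP; split; first exact: measurableT_comp.
  have /integrableP[_] := im.
  rewrite (eq_measure_integral m)//=; last by move=> A mA _; exact: mE.
  rewrite (ge0_integral_distribution V)//.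
  exact: (measurableT_comp (@abse_measurable _ _) mf).
split; first exact: iYZ.
rewrite /mean {1}/Rintegral.
have <- : (\int[m]_z f z = \int[P]_w (Y w * Z w)%:E)%E.
  by rewrite /m integral_distribution.
rewrite (eq_measure_integral (m1 \x m2)%E)//=; last by move=> A mA _; apply/esym; exact: mE.
rewrite -integral12_prod_meas1//.
have id_int (U : {RV P >-> R}) : intg P U ->
    (distribution P U).-integrable [set: R] (EFin \o idfun).
  move=> iU; apply/integrableP; split; first exact: EFin_measurable.
  rewrite (ge0_integral_distribution U)//.
    exact: cst_fin.
  exact: (measurableT_comp (@abse_measurable _ _) (@EFin_measurable _ _)).
have id_mean (U : {RV P >-> R}) : intg P U ->
    (\int[distribution P U]_y y%:E = (mean P U)%:E)%E.
  move=> iU; rewrite integral_distribution//.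
    by rewrite /mean /Rintegral fineK// integrable_fin_num.
rewrite (eq_integral (fun x : R => x%:E * (mean P Z)%:E)%E); last first.
  move=> x _; rewrite /f /fubini_F /=.
  under eq_integral do rewrite EFinM.
  by rewrite (integralZl _ (id_int Z' iZ))// id_mean.
by rewrite (integralZr _ (id_int Y' iY))// id_mean.
Qed.

End independence.

(** * The uniform law on [-1, 1] and the moments of the kernel *)

Section uniform_law.
Context {R : realType}.

Definition outside_unit : set R := ~` `[-1, 1]%classic.

Lemma measurable_outside_unit : measurable (outside_unit : set (measurableTypeR R)).
Proof. by apply: measurableC; exact: measurable_itv. Qed.

Lemma uniform_outside_unit : uniformN11 (outside_unit : set (measurableTypeR R)) = 0%E.
Proof.
rewrite /uniformN11 /= /uniform_prob integral_uniform_pdf.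
by rewrite /outside_unit setICl integral_set0.
Qed.

Context {disp : measure_display} {T : measurableType disp}.
Variable P : probability T R.

(* [R] and [measurableTypeR R] carry the same measurable sets under different
   displays, so the law of [r] is taken on the latter. *)
Lemma intg_law (r : {RV P >-> R}) (Q : probability (measurableTypeR R) R)
    (phi : R -> R) :
  (forall B : set R, measurable B -> distribution P r B = Q B) ->
  intg Q phi ->
  intg P (fun w => phi (r w)) /\ mean P (fun w => phi (r w)) = mean Q phi.
Proof.
move=> rQ iphi.
have mr : measurable_fun [set: T] (r : T -> measurableTypeR R).
  exact: (@measurable_funPT _ _ _ _ r).
pose r' : {RV P >-> measurableTypeR R} :=
  HB.pack (r : T -> measurableTypeR R) (isMeasurableFun.Build _ _ _ _ _ mr).
have r'Q A : measurable A -> distribution P r' A = Q A by exact: rQ.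
have mphi : measurable_fun [set: measurableTypeR R] (EFin \o phi).
  exact: (measurable_int _ iphi).
have iPr : intg P (fun w => phi (r w)).
  apply/integrableP; split; first exact: (measurableT_comp mphi mr).
  have /integrableP[_] := iphi.
  rewrite (eq_measure_integral (distribution P r'))//=; last first.
    by move=> A mA _; rewrite r'Q.
  rewrite (ge0_integral_distribution r')//.
  exact: (measurableT_comp (@abse_measurable _ _) mphi).
split=> //; rewrite /mean /Rintegral; congr fine.
rewrite [RHS](eq_measure_integral (distribution P r'))//=; last first.
  by move=> A mA _; rewrite r'Q.
by rewrite integral_distribution.
Qed.

End uniform_law.

Section kernel.
Context {R : realType}.
Variables (beta : R) (K : R -> R).
Hypothesis hK : kernel_cond beta K.

Notation U := (@uniformN11 R).

Lemma kernel_measurable : measurable_fun [set: R] K.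
Proof. by case: hK. Qed.

Lemma ge0_intg (f : R -> R) : measurable_fun [set: R] f -> (forall x, 0 <= f x) ->
  ('E_U[f] < +oo)%E -> intg U f.
Proof.
move=> mf f0; rewrite unlock => foo; apply/integrableP; split.
  exact/measurable_EFinP.
by under eq_integral do rewrite /= ger0_norm//.
Qed.

Lemma kernel_sqr_intg : intg U (fun r => K r ^+ 2).
Proof.
case: hK => mK _ _ _ ?; apply: ge0_intg => //.
  exact: measurable_funX.
by move=> x; rewrite sqr_ge0.
Qed.

Lemma kernel_abs_intg : intg U (fun r => `|r| `^ beta * `|K r|).
Proof.
case: hK => mK _ _ ? _; apply: ge0_intg => //.
  apply: measurable_funM; last exact: measurableT_comp.
  apply: (measurableT_comp (measurable_powR _)) => //.
Qed.

(** On [-1, 1] the integrand is at most [|K r|], hence at most [1 + K r ^+ 2], which is integrable;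
    the complement is a null set. *)
Lemma kernel_monomial_intg j : intg U (fun r => r ^+ j * K r).
Proof.
have mK := kernel_measurable.
apply: (intg_ae_dom measurable_outside_unit uniform_outside_unit _
  (intgD (intg_cst U 1) kernel_sqr_intg)).
  by apply: measurable_funM => //; exact: measurable_funX.
move=> r /contrapT /=; rewrite in_itv/= -ler_norml => r1.
rewrite normrM normrX.
have : `|r| ^+ j * `|K r| <= 1 * `|K r|.
  by rewrite ler_wpM2r// exprn_ile1.
rewrite -(real_normK (num_real (K r))); move: (normr_ge0 (K r)) => a b.
have : 0 <= (`|K r| - 1) ^+ 2 by rewrite sqr_ge0.
nra.
Qed.

Lemma kernel_moment1 : mean U (fun r => r * K r) = 1.
Proof.
case: hK => _ h _ _ _; have := kernel_monomial_intg 1.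
under eq_fun do rewrite expr1.
by move=> /expectation_mean; rewrite h => -[].
Qed.

Lemma kernel_moment j : (j == 0)%N || (2 <= j <= strict_floor beta)%N ->
  mean U (fun r => r ^+ j * K r) = 0.
Proof.
case: hK => _ _ h _ _ /h; rewrite (expectation_mean (kernel_monomial_intg j)).
by case.
Qed.

End kernel.

(** * Euclidean geometry and consensus *)

Section euclidean.
Context {R : realType}.

(** The index type is arbitrary because the same inequalities serve the coordinates of a vector, the
    family of agents, and pairs of an agent and a coordinate. *)
Definition l2 (I : finType) (a : I -> R) : R := Num.sqrt (\sum_i a i ^+ 2).

Lemma l2_ge0 (I : finType) (a : I -> R) : 0 <= l2 a.
Proof. exact: sqrtr_ge0. Qed.

Lemma sqr_l2 (I : finType) (a : I -> R) : l2 a ^+ 2 = \sum_i a i ^+ 2.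
Proof. by rewrite sqr_sqrtr// sumr_ge0// => i _; rewrite sqr_ge0. Qed.

Lemma cauchy_schwarz (I : finType) (a b : I -> R) :
  `|\sum_i a i * b i| <= l2 a * l2 b.
Proof.
set C := \sum_i _.
have key s : 0 <= l2 a ^+ 2 - 2 * s * C + s ^+ 2 * l2 b ^+ 2.
  rewrite !sqr_l2 /C !mulr_sumr -sumrB -big_split/=; apply: sumr_ge0 => i _.
  have := sqr_ge0 (a i - s * b i); nra.
have a0 := l2_ge0 a; have b0 := l2_ge0 b.
rewrite -(@ler_pXn2r _ 2)// ?nnegrE ?mulr_ge0// real_normK ?num_real//.
have [b00|bN0] := eqVneq (l2 b) 0.
  suff -> : C = 0 by rewrite expr0n sqr_ge0.
  apply/eqP; apply: contraT => C0.
  (* With [l2 b = 0] the expression is affine in [s]; this [s] gives it the value [- l2 a ^+ 2 - 2],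
     which is negative. *)
  have := key ((l2 a ^+ 2 + 1) / C).
  rewrite b00 expr0n mulr0 addr0 -mulrA divfK//.
  have := sqr_ge0 (l2 a); lra.
(* Otherwise the quadratic in [s] is evaluated at its minimum [C / l2 b ^+ 2]. *)
have bgt : 0 < l2 b ^+ 2 by rewrite exprn_gt0// lt_def bN0.
have h := mulr_ge0 (ltW bgt) (key (C / l2 b ^+ 2)).
rewrite exprMn -subr_ge0; apply: le_trans h _; rewrite le_eqVlt; apply/orP; left.
apply/eqP; field; exact: bN0.
Qed.

Lemma l2_triangle (I : finType) (a b : I -> R) :
  l2 (fun i => a i + b i) <= l2 a + l2 b.
Proof.
rewrite -(@ler_pXn2r _ 2) ?nnegrE ?addr_ge0 ?l2_ge0// sqrrD !sqr_l2.
have -> : \sum_i (a i + b i) ^+ 2 =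
    \sum_i a i ^+ 2 + (\sum_i a i * b i) *+ 2 + \sum_i b i ^+ 2.
  by rewrite -sumrMnl -!big_split/=; apply: eq_bigr => i _; rewrite sqrrD.
rewrite lerD2r lerD2l lerMn2r/=.
exact: le_trans (ler_norm _) (cauchy_schwarz a b).
Qed.

Context {d : nat}.
Implicit Types u v w : 'rV[R]_d.

Lemma enormE v : enorm v = l2 (fun i => v 0 i).
Proof. by rewrite /enorm /l2 /dotv; under eq_bigr do rewrite -expr2. Qed.

Lemma enorm_ge0 v : 0 <= enorm v. Proof. exact: sqrtr_ge0. Qed.

Lemma dotvv v : dotv v v = enorm v ^+ 2.
Proof. by rewrite enormE sqr_l2 /dotv; apply: eq_bigr => i _; rewrite expr2. Qed.

Lemma dotvDl u v w : dotv (u + v) w = dotv u w + dotv v w.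
Proof. by rewrite /dotv -big_split; apply: eq_bigr => i _; rewrite mxE mulrDl. Qed.

Lemma dotvZl c u v : dotv (c *: u) v = c * dotv u v.
Proof. by rewrite /dotv mulr_sumr; apply: eq_bigr => i _; rewrite mxE mulrA. Qed.

Lemma dotvC u v : dotv u v = dotv v u.
Proof. by rewrite /dotv; apply: eq_bigr => i _; rewrite mulrC. Qed.

Lemma dotvDr u v w : dotv u (v + w) = dotv u v + dotv u w.
Proof. by rewrite dotvC dotvDl !(dotvC u). Qed.

Lemma dotvZr c u v : dotv u (c *: v) = c * dotv u v.
Proof. by rewrite dotvC dotvZl dotvC. Qed.

Lemma dotvNl u v : dotv (- u) v = - dotv u v.
Proof. by rewrite -scaleN1r dotvZl mulN1r. Qed.

Lemma dotvNr u v : dotv u (- v) = - dotv u v.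
Proof. by rewrite dotvC dotvNl dotvC. Qed.

Lemma dotvBl u v w : dotv (u - v) w = dotv u w - dotv v w.
Proof. by rewrite dotvDl dotvNl. Qed.

Lemma dotvBr u v w : dotv u (v - w) = dotv u v - dotv u w.
Proof. by rewrite dotvDr dotvNr. Qed.

Lemma dotv_suml (I : Type) (s : seq I) (Q : pred I) (u : I -> 'rV[R]_d) v :
  dotv (\sum_(i <- s | Q i) u i) v = \sum_(i <- s | Q i) dotv (u i) v.
Proof.
rewrite /dotv exchange_big/=; apply: eq_bigr => j _.
by rewrite summxE mulr_suml.
Qed.

Lemma dotv_sumr (I : Type) (s : seq I) (Q : pred I) (u : I -> 'rV[R]_d) v :
  dotv v (\sum_(i <- s | Q i) u i) = \sum_(i <- s | Q i) dotv v (u i).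
Proof. by rewrite dotvC dotv_suml; apply: eq_bigr => i _; rewrite dotvC. Qed.

Lemma enormZ c v : enorm (c *: v) = `|c| * enorm v.
Proof.
apply/eqP; rewrite -(@eqrXn2 _ 2) ?mulr_ge0 ?enorm_ge0//.
by rewrite exprMn -!dotvv dotvZl dotvZr mulrA real_normK ?num_real.
Qed.

Lemma enormN v : enorm (- v) = enorm v.
Proof. by rewrite -scaleN1r enormZ normrN1 mul1r. Qed.

Lemma enormBC u v : enorm (u - v) = enorm (v - u).
Proof. by rewrite -enormN opprB. Qed.

Lemma dotv_le u v : `|dotv u v| <= enorm u * enorm v.
Proof. by rewrite !enormE; exact: cauchy_schwarz. Qed.

Lemma enormD u v : enorm (u + v) <= enorm u + enorm v.
Proof.
rewrite !enormE.
by under eq_fun do rewrite mxE; exact: l2_triangle.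
Qed.

Lemma sqr_enormD u v : enorm (u + v) ^+ 2 = enorm u ^+ 2 + 2 * dotv u v + enorm v ^+ 2.
Proof. by rewrite -!dotvv !dotvDl !dotvDr (dotvC v u); ring. Qed.

Lemma sqr_enormB u v : enorm (u - v) ^+ 2 = enorm u ^+ 2 - 2 * dotv u v + enorm v ^+ 2.
Proof. by rewrite sqr_enormD dotvNr enormN; ring. Qed.

Lemma enorm0 : enorm (0 : 'rV[R]_d) = 0.
Proof. by rewrite -(scale0r (0 : 'rV[R]_d)) enormZ normr0 mul0r. Qed.

Lemma ler_coord_enorm v i : `|v 0 i| <= enorm v.
Proof.
rewrite -(@ler_pXn2r _ 2) ?nnegrE ?enorm_ge0// real_normK ?num_real//.
rewrite enormE sqr_l2 (bigD1 i)//= lerDl sumr_ge0// => j _.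
by rewrite sqr_ge0.
Qed.

Lemma enorm_le_norm v : enorm v <= Num.sqrt d%:R * `|v|.
Proof.
rewrite -(@ler_pXn2r _ 2) ?nnegrE ?mulr_ge0 ?sqrtr_ge0 ?enorm_ge0//.
rewrite enormE sqr_l2 exprMn sqr_sqrtr//.
apply: (@le_trans _ _ (\sum_(i < d) `|v| ^+ 2)).
  apply: ler_sum => i _; rewrite -[X in X <= _]real_normK ?num_real//.
  rewrite ler_pXn2r ?nnegrE// [leRHS]mx_normE.
  exact: (le_bigmax _ (fun k : 'I_1 * 'I_d => `|v k.1 k.2|%:nng) (0, i)).
by rewrite sumr_const card_ord mulr_natl.
Qed.

Lemma enorm_continuous : continuous (@enorm R d).
Proof.
move=> v; apply/(@cvgrPdist_le _ _ _ (nbhs v) (nbhs_filter v)) => e e0; near=> u.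
have h : `|enorm v - enorm u| <= enorm (v - u).
  rewrite ler_norml; apply/andP; split.
    rewrite lerNl opprB lerBlDr enormBC.
    by apply: le_trans (enormD _ _); rewrite subrK.
  by rewrite lerBlDr; apply: le_trans (enormD _ _); rewrite subrK.
apply: le_trans h (le_trans (enorm_le_norm _) _).
(* Adding 1 keeps the divisor positive even when [d = 0]. *)
have s0 : 0 < Num.sqrt d%:R + 1 :> R by rewrite ltr_wpDl// sqrtr_ge0.
apply: (@le_trans _ _ ((Num.sqrt d%:R + 1) * `|v - u|)).
  by rewrite ler_wpM2r// lerDl.
rewrite mulrC -ler_pdivlMr//; near: u.
by apply: cvgr_dist_le => //; exact: divr_gt0.
Unshelve. all: by end_near. Qed.

End euclidean.

(** * Euclidean projection onto a compact convex set *)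

Section projection.
Context {R : realType} {d : nat}.
Variable Theta : set 'rV[R]_d.
Hypotheses (Theta0 : Theta !=set0) (cTheta : compact Theta)
  (convTheta : convex_set Theta).
Implicit Types u v z : 'rV[R]_d.

(** A continuous function attains its minimum on a nonempty compact set, so the default value of
    [xget] is never returned. *)
Lemma eprojP u : Theta (eproj Theta u) /\
  forall z, Theta z -> enorm (u - eproj Theta u) <= enorm (u - z).
Proof.
have [|c cT cmin] := @EVT_min_rV R d (fun y => enorm (u - y)) Theta Theta0 cTheta.
  apply: continuous_subspaceT => y.
  have h : {for y, continuous (fun y : 'rV[R]_d => u - y)}.
    by apply: continuousB; [exact: cst_continuous|].
  exact: (@continuous_comp _ _ _ _ _ _ h (@enorm_continuous R d _)).
rewrite /eproj; case: xgetP => [y -> []//|/(_ c)].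
by case; split=> [|z zT]; [exact: set_mem|apply: cmin; rewrite inE].
Qed.

Lemma eproj_in u : Theta (eproj Theta u).
Proof. by have [] := eprojP u. Qed.

Lemma eproj_variational u z : Theta z ->
  dotv (u - eproj Theta u) (z - eproj Theta u) <= 0.
Proof.
move=> zT; have [pT pmin] := eprojP u; set p := eproj Theta u in pT pmin *.
rewrite leNgt; apply/negP; set a := dotv _ _ => a0.
set b := enorm (z - p) ^+ 2; have b0 : 0 <= b by rewrite sqr_ge0.
have ab : 0 < a + b by rewrite ltr_pwDl.
(* Moving from the projection towards [z] by [s] changes the squared distance by
   [- 2 * s * a + s ^+ 2 * b]. This [s] lies in ]0, 1] and satisfies [s * b <= a], so the change is
   at most [- s * a < 0], against minimality. The denominator [a + b] also covers [b = 0]. *)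
pose s := a / (a + b).
have s0 : 0 < s by rewrite divr_gt0.
have s1 : s <= 1 by rewrite ler_pdivrMr// mul1r lerDl.
have yT : Theta (p + s *: (z - p)).
  have := @convTheta z p (Itv01 (ltW s0) s1) (mem_set zT) (mem_set pT).
  rewrite inE; congr (Theta _); rewrite /conv/= /unstable.onem scalerBl scale1r scalerBr.
  by rewrite addrCA.
have := pmin _ yT; rewrite opprD addrA => h.
have : enorm (u - p) ^+ 2 <= enorm (u - p - s *: (z - p)) ^+ 2.
  by rewrite ler_pXn2r ?nnegrE ?enorm_ge0.
rewrite (sqr_enormB (u - p)) dotvZr enormZ exprMn real_normK ?num_real// -/a -/b.
have sb : s * b <= a.
  by rewrite /s mulrAC ler_pdivrMr// ler_wpM2l ?(ltW a0)// lerDr ltW.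
have : s * (s * b) <= s * a by rewrite ler_wpM2l// ltW.
have : 0 < s * a by rewrite mulr_gt0.
nra.
Qed.

Lemma eproj_id u : Theta u -> eproj Theta u = u.
Proof.
move=> uT; have [_ /(_ u uT)] := eprojP u.
rewrite subrr enorm0 => h; apply/rowP => j; apply/eqP; rewrite -subr_eq0 -normr_le0.
have := ler_coord_enorm (eproj Theta u - u) j; rewrite !mxE enormBC => h1.
exact: le_trans h1 h.
Qed.

(** Test the variational inequality of each point at the projection of the other one: the sum bounds
    the squared distance of the projections by [dotv (u - v) (p - q)], and Cauchy-Schwarz
    concludes. *)
Lemma eproj_nonexpansive u v :
  enorm (eproj Theta u - eproj Theta v) <= enorm (u - v).
Proof.
set p := eproj Theta u; set q := eproj Theta v.
have h1 : dotv (u - p) (q - p) <= 0 by apply: eproj_variational; exact: eproj_in.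
have h2 : dotv (v - q) (p - q) <= 0 by apply: eproj_variational; exact: eproj_in.
have : enorm (p - q) ^+ 2 <= enorm (u - v) * enorm (p - q).
  apply: le_trans (le_trans (ler_norm _) (dotv_le (u - v) (p - q))).
  rewrite -dotvv; move: h1 h2; rewrite !(dotvBl, dotvBr) (dotvC q p); lra.
have [->|pq] := eqVneq (enorm (p - q)) 0; first by rewrite enorm_ge0.
by rewrite expr2 ler_pM2r// lt_def pq enorm_ge0.
Qed.

(* The combination equals its own projection: average the variational
   inequality over the [z i]. *)
Lemma convex_combination (I : finType) (a : I -> R) (z : I -> 'rV[R]_d) :
  (forall i, 0 <= a i) -> \sum_i a i = 1 -> (forall i, Theta (z i)) ->
  Theta (\sum_i a i *: z i).
Proof.
move=> a0 a1 zT; set y := \sum_i _; pose p := eproj Theta y.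
suff yp : y = p by rewrite yp; exact: eproj_in.
have : dotv (y - p) (y - p) <= 0.
  have -> : dotv (y - p) (y - p) = \sum_i a i * dotv (y - p) (z i - p).
    have {2}-> : y - p = \sum_i a i *: (z i - p).
      under eq_bigr do rewrite scalerBr.
      by rewrite sumrB -scaler_suml a1 scale1r.
    by rewrite dotv_sumr; apply: eq_bigr => i _; rewrite dotvZr.
  by apply: sumr_le0 => i _; apply: mulr_ge0_le0 => //; exact: eproj_variational.
rewrite dotvv => h; apply/rowP => j; apply/eqP; rewrite -subr_eq0 -normr_le0.
have := ler_coord_enorm (y - p) j; rewrite !mxE => h1; apply: le_trans h1 _.
by rewrite -(@ler_pXn2r _ 2) ?nnegrE ?enorm_ge0// expr0n.
Qed.

End projection.

(** * Spectral norm and mixing by a doubly stochastic matrix *)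

Section consensus.
Context {R : realType}.

Lemma spectral_norm_ge n (M : 'M[R]_n) (v : 'rV[R]_n) : enorm v <= 1 ->
  enorm (v *m M^T) <= spectral_norm M.
Proof.
move=> v1; rewrite /spectral_norm; apply: ub_le_sup; last by exists v.
(* The Frobenius norm bounds the set, so that its [sup] is a genuine supremum. *)
exists (l2 (fun i => enorm (row i M))) => _ [u /= u1 <-].
rewrite -(@ler_pXn2r _ 2) ?nnegrE ?enorm_ge0 ?l2_ge0//.
rewrite enormE !sqr_l2; apply: ler_sum => i _.
have -> : (u *m M^T) 0 i = dotv u (row i M).
  by rewrite mxE; apply: eq_bigr => k _; rewrite !mxE.
rewrite -[leLHS]real_normK ?num_real// ler_pXn2r ?nnegrE ?enorm_ge0//.
apply: le_trans (dotv_le _ _) _.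
by rewrite -[leRHS]mul1r ler_wpM2r ?enorm_ge0.
Qed.

Lemma spectral_norm_ge0 n (M : 'M[R]_n) : 0 <= spectral_norm M.
Proof.
apply: le_trans (enorm_ge0 (0 *m M^T)) (spectral_norm_ge _ _).
by rewrite enorm0.
Qed.

Lemma spectral_norm_le n (M : 'M[R]_n) (v : 'rV[R]_n) :
  enorm (v *m M^T) <= spectral_norm M * enorm v.
Proof.
have [v0|vN0] := eqVneq (enorm v) 0.
  have -> : v = 0.
    apply/rowP => j; rewrite [RHS]mxE; apply/eqP; rewrite -normr_le0 -[leRHS]v0.
    exact: ler_coord_enorm.
  by rewrite mul0mx enorm0 mulr0.
have vgt : 0 < enorm v by rewrite lt_def vN0 enorm_ge0.
have := @spectral_norm_ge n M ((enorm v)^-1 *: v).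
rewrite -scalemxAl !enormZ gtr0_norm ?invr_gt0// mulVf// => /(_ (lexx _)).
by rewrite mulrC ler_pdivrMr.
Qed.

Context {n d : nat}.
Implicit Types x z : 'I_n -> 'rV[R]_d.

Definition avgv x : 'rV[R]_d := n%:R^-1 *: \sum_i x i.

Definition dispersion x : R :=
  Num.sqrt (n%:R^-1 * \sum_i enorm (x i - avgv x) ^+ 2).

Definition rms x : R := Num.sqrt (n%:R^-1 * \sum_i enorm (x i) ^+ 2).

Hypothesis n0 : (0 < n)%N.

Let nneq0 : n%:R != 0 :> R. Proof. by rewrite pnatr_eq0 -lt0n. Qed.

Let ninv_ge0 : 0 <= n%:R^-1 :> R. Proof. by rewrite invr_ge0. Qed.

Lemma sum_sqr_ge0 x : 0 <= n%:R^-1 * \sum_i enorm (x i) ^+ 2.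
Proof. by rewrite mulr_ge0// sumr_ge0// => i _; rewrite sqr_ge0. Qed.

Lemma sqr_rms x : rms x ^+ 2 = n%:R^-1 * \sum_i enorm (x i) ^+ 2.
Proof. by rewrite sqr_sqrtr// sum_sqr_ge0. Qed.

Lemma rms_ge0 x : 0 <= rms x. Proof. exact: sqrtr_ge0. Qed.

Lemma dispersionE x : dispersion x = rms (fun i => x i - avgv x).
Proof. by []. Qed.

Lemma dispersion_ge0 x : 0 <= dispersion x. Proof. exact: sqrtr_ge0. Qed.

(** Seen as one vector indexed by agents and coordinates, a family inherits the triangle inequality
    of [l2]. *)
Lemma rmsE x : rms x = Num.sqrt n%:R^-1 * l2 (fun ij : 'I_n * 'I_d => x ij.1 0 ij.2).
Proof.
rewrite /rms sqrtrM// /l2 -(pair_bigA _ (fun i j => x i 0 j ^+ 2))/=.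
congr (_ * Num.sqrt _).
by apply: eq_bigr => i _; rewrite enormE sqr_l2.
Qed.

Lemma rmsD x z : rms (fun i => x i + z i) <= rms x + rms z.
Proof.
rewrite !rmsE -mulrDr ler_wpM2l ?sqrtr_ge0//.
under eq_fun do rewrite mxE.
exact: l2_triangle.
Qed.

Lemma avg_le_rms x : n%:R^-1 * \sum_i enorm (x i) <= rms x.
Proof.
rewrite -(@ler_pXn2r _ 2) ?nnegrE ?rms_ge0//; last first.
  by rewrite mulr_ge0// sumr_ge0// => i _; exact: enorm_ge0.
have := cauchy_schwarz (fun i => enorm (x i)) (fun=> 1 : R).
under eq_bigr do rewrite mulr1.
rewrite ger0_norm; last by rewrite sumr_ge0// => i _; exact: enorm_ge0.
set S := \sum_i _ => h.
have S0 : 0 <= S by rewrite sumr_ge0// => i _; exact: enorm_ge0.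
have : S ^+ 2 <= (\sum_i enorm (x i) ^+ 2) * n%:R.
  have -> : n%:R = l2 (fun _ : 'I_n => 1 : R) ^+ 2 :> R.
    rewrite sqr_l2.
    by under eq_bigr do rewrite expr1n; rewrite sumr_const card_ord.
  rewrite -sqr_l2 -exprMn ler_pXn2r ?nnegrE ?mulr_ge0 ?l2_ge0//.
rewrite sqr_rms exprMn expr2 -mulrA => h2.
rewrite ler_wpM2l// mulrC ler_pdivrMr// lt_def nneq0//=.
Qed.

Lemma sum_sub_avgv x : \sum_i (x i - avgv x) = 0.
Proof.
rewrite sumrB sumr_const card_ord /avgv -scaler_nat scalerA divff// scale1r.
by rewrite subrr.
Qed.

(** The cross terms cancel because deviations from the mean sum to zero. This isolates the only part
    on which mixing acts, the dispersion. *)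
Lemma bias_variance x (z : 'rV[R]_d) : n%:R^-1 * \sum_i enorm (x i - z) ^+ 2 =
  enorm (avgv x - z) ^+ 2 + dispersion x ^+ 2.
Proof.
rewrite dispersionE sqr_rms.
have E i : enorm (x i - z) ^+ 2 = enorm (x i - avgv x) ^+ 2 +
    2 * dotv (x i - avgv x) (avgv x - z) + enorm (avgv x - z) ^+ 2.
  by rewrite -sqr_enormD addrA subrK.
under eq_bigr do rewrite E.
rewrite !big_split/= -mulr_sumr -dotv_suml sum_sub_avgv sumr_const card_ord.
have -> : dotv 0 (avgv x - z) = 0 by rewrite -(scale0r (0 : 'rV_d)) dotvZl mul0r.
rewrite mulr0 addr0 mulrDr addrC; congr (_ + _).
by rewrite -[X in _ * X]mulr_natl mulrA mulVf// mul1r.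
Qed.

Lemma dispersion_le_rms x : dispersion x <= rms x.
Proof.
rewrite -(@ler_pXn2r _ 2) ?nnegrE ?rms_ge0 ?dispersion_ge0//.
have := bias_variance x 0; rewrite (sqr_rms x); under eq_bigr do rewrite subr0.
by move=> ->; rewrite lerDr sqr_ge0.
Qed.

Lemma dispersionD x z : dispersion (fun i => x i + z i) <= dispersion x + dispersion z.
Proof.
rewrite !dispersionE; apply: le_trans (rmsD _ _); rewrite le_eqVlt; apply/orP; left.
apply/eqP; congr rms; apply/funext => i.
by rewrite /avgv big_split/= scalerDr opprD addrACA.
Qed.

(** A deviation from the mean is the average of the differences [x i - x j] over [j]. *)
Lemma dispersion_le x M : (forall i j, enorm (x i - x j) <= M) -> 0 <= M ->
  dispersion x <= M.
Proof.
move=> xM M0; rewrite -(@ler_pXn2r _ 2) ?nnegrE ?dispersion_ge0//.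
rewrite dispersionE sqr_rms.
suff : \sum_i enorm (x i - avgv x) ^+ 2 <= n%:R * M ^+ 2.
  by rewrite ler_pdivrMl ?ltr0n.
rewrite mulr_natl -[X in _ *+ X]card_ord -sumr_const; apply: ler_sum => i _.
rewrite ler_pXn2r ?nnegrE ?enorm_ge0//.
have -> : x i - avgv x = n%:R^-1 *: \sum_j (x i - x j).
  rewrite sumrB sumr_const card_ord scalerBr -[X in _ *: X - _]scaler_nat.
  by rewrite scalerA mulVf// scale1r.
rewrite enormZ ger0_norm// ler_pdivrMl ?ltr0n//.
have en (s : seq 'I_n) : enorm (\sum_(j <- s) (x i - x j)) <= \sum_(j <- s) M.
  elim: s => [|a s IH]; first by rewrite !big_nil enorm0.
  rewrite !big_cons; apply: le_trans (enormD _ _) _.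
  by apply: lerD.
by apply: le_trans (en _) _; rewrite sumr_const card_ord mulr_natl.
Qed.

Variable W : 'M[R]_n.
Hypothesis hW : doubly_stochastic W.

Definition mix z i : 'rV[R]_d := \sum_(k < n) W i k *: z k.

Lemma avgv_mix z : avgv (mix z) = avgv z.
Proof.
case: hW => _ _ Wc; rewrite /avgv /mix exchange_big/=; congr (_ *: _).
by apply: eq_bigr => k _; rewrite -scaler_suml Wc scale1r.
Qed.

Let M := W - n%:R^-1 *: ((const_mx 1 : 'cV[R]_n) *m (const_mx 1 : 'cV[R]_n)^T).

(** Unit column sums preserve the mean and unit row sums let it be subtracted inside the mixing, so
    the deviations themselves are multiplied by [W]. They sum to zero, hence [W] acts on them as
    [M], separately in each coordinate. *)
Lemma dispersion_mix z : dispersion (mix z) <= spectral_norm M * dispersion z.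
Proof.
rewrite !dispersionE !rmsE mulrCA ler_wpM2l ?sqrtr_ge0//.
rewrite -(@ler_pXn2r _ 2) ?nnegrE ?mulr_ge0 ?l2_ge0 ?spectral_norm_ge0//.
rewrite exprMn !sqr_l2.
rewrite -(pair_bigA _ (fun i j => (mix z i - avgv (mix z)) 0 j ^+ 2))/=.
rewrite -(pair_bigA _ (fun i j => (z i - avgv z) 0 j ^+ 2))/=.
rewrite exchange_big [in leRHS]exchange_big/= mulr_sumr; apply: ler_sum => j _.
pose v : 'rV[R]_n := \row_k (z k - avgv z) 0 j.
have -> : \sum_i (z i - avgv z) 0 j ^+ 2 = enorm v ^+ 2.
  by rewrite enormE sqr_l2; apply: eq_bigr => i _; rewrite [in RHS]mxE.
have -> : \sum_i (mix z i - avgv (mix z)) 0 j ^+ 2 = enorm (v *m M^T) ^+ 2.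
  rewrite enormE sqr_l2; apply: eq_bigr => i _; congr (_ ^+ 2).
  rewrite avgv_mix [in RHS]mxE.
  have -> : \sum_k v 0 k * M^T k i =
      \sum_k (W i k * (z k - avgv z) 0 j) - n%:R^-1 * (\sum_k (z k - avgv z)) 0 j.
    rewrite summxE mulr_sumr -sumrB; apply: eq_bigr => k _.
    rewrite /v !mxE big_ord1 !mxE mulr1; ring.
  rewrite sum_sub_avgv [X in _ - _ * X]mxE mulr0 subr0.
  case: hW => _ Wr _.
  transitivity (\sum_k W i k * z k 0 j - (\sum_k W i k) * avgv z 0 j).
    rewrite Wr mul1r [LHS]mxE [X in _ + X]mxE /mix summxE; congr (_ - _).
    by apply: eq_bigr => k _; rewrite [LHS]mxE.
  rewrite mulr_suml -sumrB; apply: eq_bigr => k _.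
  by rewrite [(z k - _) 0 j]mxE [X in _ = _ * (_ + X)]mxE mulrBr.
rewrite -exprMn ler_pXn2r ?nnegrE ?mulr_ge0 ?enorm_ge0 ?spectral_norm_ge0//.
exact: spectral_norm_le.
Qed.

End consensus.

(** * Random vectors and directional Taylor expansions *)

Section measurable_vectors.
Context {R : realType} {disp : measure_display} {T : measurableType disp}.
Context {d : nat}.
Implicit Types (X : T -> 'rV[R]_d) (F : 'rV[R]_d -> R).

Definition vmeasurable X :=
  forall j : 'I_d, measurable_fun [set: T] (fun w => X w 0 j).

(** Rounding to a grid of mesh [1 / (m + 1)] takes countably many values, so its composition with
    any [F] is measurable; letting [m] grow reaches continuous functions of a vector whose
    coordinates are measurable. *)
Definition grid_round (m : nat) (v : 'rV[R]_d) : 'rV[R]_d :=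
  \row_i ((Num.floor (m.+1%:R * v 0 i))%:~R / m.+1%:R).

Lemma grid_round_near m v : `|v - grid_round m v| <= m.+1%:R^-1.
Proof.
suff h j : `|(v - grid_round m v) 0 j| <= m.+1%:R^-1.
  have [E|/mx_norm_neq0[[i j] E]] := eqVneq (mx_norm (v - grid_round m v)) 0.
    by rewrite [leLHS]E.
  by rewrite [leLHS]E /= ord1.
rewrite !mxE; set a := v 0 j.
have m0 : 0 < m.+1%:R :> R by rewrite ltr0n.
have -> : a - (Num.floor (m.+1%:R * a))%:~R / m.+1%:R =
    (m.+1%:R * a - (Num.floor (m.+1%:R * a))%:~R) / m.+1%:R.
  by field; rewrite gt_eqF.
have /andP[h1 h2] := floor_itv (m.+1%:R * a).
rewrite normrM [X in _ * X]ger0_norm ?invr_ge0 ?(ltW m0)//.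
rewrite -[leRHS]mul1r ler_wpM2r ?invr_ge0 ?(ltW m0)//.
rewrite ger0_norm ?subr_ge0// lerBlDl ltW//.
by move: h2; rewrite intrD.
Qed.

Lemma grid_round_cvg v : grid_round ^~ v @ \oo --> v.
Proof.
apply/(@cvgrPdist_le _ _ _ \oo) => e e0; near=> m.
apply: le_trans (grid_round_near m v) _.
by apply: ltW; near: m; exact: (near_infty_natSinv_lt (PosNum e0)).
Unshelve. all: by end_near. Qed.

Lemma measurable_grid_round F X m : vmeasurable X ->
  measurable_fun [set: T] (fun w => F (grid_round m (X w))).
Proof.
move=> mX _ B mB; rewrite setTI.
pose val (z : {ffun 'I_d -> int}) : 'rV[R]_d := \row_i ((z i)%:~R / m.+1%:R).
rewrite (_ : _ @^-1` B = \bigcup_(z in [set z | B (F (val z))])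
    \bigcap_(i in [set: 'I_d]) [set w | Num.floor (m.+1%:R * X w 0 i) = z i]).
  rewrite bigcup_mkcond; apply: countable_bigcupT_measurable => // z.
  case: ifP => // _; apply: fin_bigcap_measurable => // i _.
  have mXi : measurable_fun [set: T] (fun w => m.+1%:R * X w 0 i).
    exact: measurable_funM.
  have := mXi measurableT _ (measurable_itv `[(z i)%:~R, (z i + 1)%:~R[%R).
  rewrite setTI; congr (measurable _); apply/seteqP; split=> w /=.
    by rewrite in_itv/= => h; exact: floor_def.
  by rewrite in_itv/= => <-; exact: floor_itv.
apply/seteqP; split=> [w /= BFw|w [z /= Bz zw]].
  exists [ffun i => Num.floor (m.+1%:R * X w 0 i)].
    rewrite /=; move: BFw; congr (B (F _)).
    by apply/rowP => i; rewrite !mxE ffunE.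
  by move=> i _ /=; rewrite ffunE.
move: Bz; congr (B (F _)); apply/rowP => i; rewrite !mxE.
by have /= := zw i I => ->.
Qed.

Lemma measurable_continuous_comp F X : continuous F -> vmeasurable X ->
  measurable_fun [set: T] (fun w => F (X w)).
Proof.
move=> cF mX.
apply: (@measurable_fun_cvg _ _ _ _ (fun m w => F (grid_round m (X w)))).
  by move=> m; exact: measurable_grid_round.
move=> w _; apply: (@cvg_comp _ _ _ (grid_round ^~ (X w)) F).
  exact: grid_round_cvg.
exact: cF.
Qed.

End measurable_vectors.

(** * Taylor expansion along a coordinate axis *)

Section directional_taylor.
Context {R : realType} {d : nat}.
Implicit Types (F : 'rV[R]_d -> R) (x z : 'rV[R]_d) (j : 'I_d).

Lemma enorm_basis j : enorm (basis_vec j : 'rV[R]_d) = 1.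
Proof.
rewrite /enorm /dotv (bigD1 j)//= big1 => [|i /negbTE ij].
  by rewrite !mxE !eqxx mulr1 addr0 sqrtr1.
by rewrite !mxE ij andbF mulr0.
Qed.

Definition coef F j k : 'rV[R]_d -> R := iter k (pderiv j) F.

Lemma foldr_pderiv l F (m : {ffun 'I_d -> 'I_l.+1}) j (s : seq 'I_d) :
  uniq s -> (forall i, i != j -> m i = ord0) ->
  foldr (fun i G => iter (m i) (pderiv i) G) F s =
  if j \in s then iter (m j) (pderiv j) F else F.
Proof.
move=> + m0; elim: s => //= a s IH /andP[aNs us].
rewrite IH// inE; have [->|ja] := eqVneq j a; first by rewrite (negbTE aNs).
by rewrite m0 1?eq_sym.
Qed.

(** The increment vanishes off coordinate [j], so a multi-index with a nonzero entry elsewhere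
    contributes 0; the others are the [emb k], concentrated at [j]. *)
Lemma taylor_basis l F x j (s : R) :
  taylor l F x (x + s *: basis_vec j) =
  \sum_(k < l.+1) k`!%:R^-1 * coef F j k x * s ^+ k.
Proof.
rewrite /taylor.
pose emb (k : 'I_l.+1) : {ffun 'I_d -> 'I_l.+1} :=
  [ffun i => if i == j then k else ord0].
pose t (m : {ffun 'I_d -> 'I_l.+1}) :=
  (mfact m)%:R^-1 * mderiv m F x * mpow (x + s *: basis_vec j - x) m.
have t0 (m : {ffun 'I_d -> 'I_l.+1}) : emb (m j) != m -> t m = 0.
  move=> hm; suff [i ij mi] : exists2 i, i != j & m i != ord0.
    rewrite /t /mpow (bigD1 i)//= addrAC subrr add0r !mxE (negbTE ij) andbF mulr0.
    by rewrite expr0n; move: mi; rewrite -val_eqE/= => /negbTE ->; rewrite mul0r mulr0.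
  apply/exists_inP; apply: contraR hm => /exists_inPn h; apply/eqP/ffunP => i.
  rewrite ffunE; case: eqVneq => [->//|ij].
  by have := h i ij; rewrite negbK => /eqP ->.
transitivity (\sum_(m : {ffun 'I_d -> 'I_l.+1} | (mdeg m <= l)%N) t m); first by [].
rewrite (bigID (fun m : {ffun 'I_d -> 'I_l.+1} => emb (m j) == m))/=.
rewrite [X in _ + X]big1 ?addr0; last first.
  by move=> m /andP[_]; exact: t0.
rewrite (reindex_onto emb (fun m : {ffun 'I_d -> 'I_l.+1} => m j))/=; last first.
  by move=> m /andP[_ /eqP].
have ej k : emb k j = k by rewrite ffunE eqxx.
have deg k : mdeg (emb k) = k.
  rewrite /mdeg (bigD1 j)//= ej big1 ?addn0// => i /negbTE ij.
  by rewrite ffunE ij.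
apply: eq_big => [k|k _].
  by rewrite ej !eqxx deg -ltnS ltn_ord.
rewrite /t; congr (_^-1 * _ * _).
- congr (_%:R); rewrite /mfact (bigD1 j)//= ej big1 ?muln1// => i /negbTE ij.
  by rewrite ffunE ij.
- rewrite /mderiv (@foldr_pderiv l F (emb k) j) ?enum_uniq ?mem_enum ?ej//.
  by move=> i /negbTE ij; rewrite ffunE ij.
- rewrite /mpow (bigD1 j)//= ej big1 ?mulr1 => [|i /negbTE ij].
    by rewrite addrAC subrr add0r !mxE !eqxx mulr1.
  by rewrite ffunE ij expr0.
Qed.

Lemma holder_taylor (beta L : R) F x j (s : R) : holder_class beta L F ->
  `|F (x + s *: basis_vec j) -
    \sum_(k < (strict_floor beta).+1) k`!%:R^-1 * coef F j k x * s ^+ k|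
  <= L * `|s| `^ beta.
Proof.
move=> [_ /(_ x (x + s *: basis_vec j))]; rewrite taylor_basis.
by rewrite (addrAC x) subrr add0r enormZ enorm_basis mulr1.
Qed.

Lemma coef_differentiable l F j k x : times_differentiable l F -> (k < l)%N ->
  differentiable (coef F j k) x.
Proof.
rewrite /coef; elim: l F k => // l IH F [|k] [dF dpF] kl; first exact: dF.
by rewrite iterSr; apply: IH => //; exact: dpF.
Qed.

Lemma coef_continuous l F j k : times_differentiable l F -> (k < l)%N ->
  continuous (coef F j k).
Proof. by move=> dF kl x; apply/differentiable_continuous/(coef_differentiable _ _ dF). Qed.

Lemma line_is_derive F j x (s : R) : (forall y, differentiable F y) ->
  is_derive s 1 (fun s : R => F (x + s *: basis_vec j))
    (pderiv j F (x + s *: basis_vec j)).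
Proof.
move=> dF; set e := basis_vec j.
have E : (fun h : R => h^-1 *: (((fun s : R => F (x + s *: e)) \o shift s) (h *: 1) -
      F (x + s *: e))) =
    (fun h : R => h^-1 *: ((F \o shift (x + s *: e)) (h *: e) - F (x + s *: e))).
  apply/funext => h; congr (_ *: (_ - _)); rewrite /=; congr F.
  by rewrite /shift/= [_ *: 1]mulr1 scalerDl addrCA.
have dv : derivable F (x + s *: e) e by exact: diff_derivable.
split.
  by move: dv; rewrite /derivable E.
by rewrite /pderiv /derive E.
Qed.

End directional_taylor.

(** * Difference bounds, measurability and boundedness of derivatives *)

Section smooth_functions.
Context {R : realType} {d : nat}.
Implicit Types (F : 'rV[R]_d -> R) (x z : 'rV[R]_d) (j : 'I_d).

Lemma gradient_coord F x j : gradient F x 0 j = pderiv j F x.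
Proof. by rewrite mxE. Qed.

Lemma two_smooth_pderiv Lbar F x j (s : R) : two_smooth Lbar F ->
  `|pderiv j F (x + s *: basis_vec j)| <= `|pderiv j F x| + Lbar * `|s|.
Proof.
move=> [_ /(_ (x + s *: basis_vec j) x)].
rewrite addrAC subrr add0r enormZ enorm_basis mulr1 => h.
have := le_trans (ler_coord_enorm _ j) h.
rewrite mxE [X in _ + X]mxE !gradient_coord => h1.
rewrite -lerBlDl; apply: le_trans h1; exact: lerB_dist.
Qed.

(** Mean value theorem on [-s, s]. The factor [|s|] cancels the division by [2 * h] in the
    estimator, so that only the noise is amplified by small [h]. *)
Lemma central_difference Lbar F x j (s : R) : 0 <= Lbar -> two_smooth Lbar F ->
  `|F (x + s *: basis_vec j) - F (x - s *: basis_vec j)| <=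
  2 * `|s| * (`|pderiv j F x| + Lbar * `|s|).
Proof.
move=> L0 sF; set e := basis_vec j.
wlog s0 : s / 0 <= s => [hw|].
  have [/hw//|s0] := leP 0 s.
  have := hw (- s); rewrite oppr_ge0 => /(_ (ltW s0)).
  by rewrite normrN scaleNr opprK distrC.
pose g (u : R) := F (x + u *: e).
have dg (u : R) : is_derive u 1 g (pderiv j F (x + u *: e)).
  by apply: line_is_derive; case: sF.
have ss : - s <= s by rewrite ge0_cp.
have cg : {within `[- s, s], continuous g}.
  apply: continuous_subspaceT => u; apply: differentiable_continuous.
  by apply/derivable1_diffP; have [] := dg u.
have [c] := @MVT_segment R g (fun u => pderiv j F (x + u *: e)) (- s) s ss
  (fun u _ => dg u) cg.
rewrite in_itv/= -ler_norml => cs; rewrite /g scaleNr opprK => ->.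
rewrite normrM mulrC ler_pM//.
  by rewrite -mulr2n -[s *+ 2]mulr_natl normrM normr_nat.
apply: le_trans (two_smooth_pderiv _ _ _ sF) _.
by rewrite lerD2l ler_wpM2l// (le_trans cs)// ler_norm.
Qed.

(** Below order [l] continuity is enough. At order [l] the derivative is the pointwise limit of
    difference quotients, with steps [1 / (m + 1)], of the continuous derivative of order
    [l - 1]. *)
Lemma measurable_coef {disp : measure_display} {T : measurableType disp} l F j k
    (X : T -> 'rV[R]_d) :
  times_differentiable l F -> (0 < l)%N -> (k <= l)%N -> vmeasurable X ->
  measurable_fun [set: T] (fun w => coef F j k (X w)).
Proof.
move=> dF l0; rewrite leq_eqVlt => /predU1P[->{k}|kl] mX; last first.
  exact: (measurable_continuous_comp (@coef_continuous _ _ _ F j k dF kl) mX).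
have lpred : (l.-1 < l)%N by rewrite prednK.
have cF := @coef_continuous _ _ l F j l.-1 dF lpred.
pose e : 'rV[R]_d := basis_vec j.
pose hn (m : nat) (w : T) :=
  m.+1%:R * (coef F j l.-1 (X w + m.+1%:R^-1 *: e) - coef F j l.-1 (X w)).
apply: (@measurable_fun_cvg _ _ _ _ hn).
  move=> m; apply: measurable_funM => //; apply: measurable_funB; last first.
    exact: measurable_continuous_comp.
  apply: measurable_continuous_comp => // i.
  under eq_fun do rewrite mxE.
  by apply: measurable_funD => //; exact: mX.
move=> w _.
have dv : derivable (coef F j l.-1) (X w) e.
  exact/diff_derivable/(coef_differentiable _ _ dF).
have E : coef F j l (X w) = 'D_e (coef F j l.-1) (X w).
  by rewrite -{1}(prednK l0).
rewrite E; rewrite /derive.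
have hnE m : hn m w = (fun h : R => h^-1 *: ((coef F j l.-1 \o shift (X w)) (h *: e)
    - coef F j l.-1 (X w))) m.+1%:R^-1.
  by rewrite /hn /= invrK /shift/= [X w + _]addrC.
rewrite (_ : hn ^~ w = (fun h : R => h^-1 *: ((coef F j l.-1 \o shift (X w)) (h *: e)
    - coef F j l.-1 (X w))) \o (fun m : nat => m.+1%:R^-1)); last first.
  by apply/funext => m; rewrite hnE.
apply: (@cvg_comp _ _ _ (fun m : nat => m.+1%:R^-1 : R) _ \oo (0^')%R _); last exact: dv.
move=> A [eps /= e0 hA]; rewrite /= .
near=> m; apply: hA => /=.
  rewrite sub0r normrN ger0_norm// ; near: m; exact: (near_infty_natSinv_lt (PosNum e0)).
by rewrite invr_eq0.
Unshelve. all: by end_near. Qed.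

Lemma continuous_bounded_on (Theta : set 'rV[R]_d) F : Theta !=set0 ->
  compact Theta -> continuous F -> exists M, forall x, Theta x -> `|F x| <= M.
Proof.
move=> T0 cT cF.
have cN : {within Theta, continuous (fun y => `|F y|)}.
  apply: continuous_subspaceT => y.
  exact: (@continuous_comp _ _ _ F (@Num.norm _ R) y (cF y) (@norm_continuous _ _ _)).
have [c _ h] := EVT_max_rV T0 cT cN.
by exists `|F c| => x xT; apply: h; rewrite inE.
Qed.

(* The coefficient of top order need not be continuous; it is bounded because
   the Taylor estimate with step 1 bounds it by the other ones. *)
Lemma coef_bounded (Theta : set 'rV[R]_d) (beta L : R) F j k : 0 <= L ->
  Theta !=set0 -> compact Theta -> (0 < strict_floor beta)%N ->
  holder_class beta L F ->
  (k <= strict_floor beta)%N ->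
  exists M, forall x, Theta x -> `|coef F j k x| <= M.
Proof.
move=> L0 T0 cT l0 hF.
rewrite leq_eqVlt => /predU1P[->{k}|kl]; last first.
  by apply: continuous_bounded_on => //; case: hF => dF _; exact: (coef_continuous dF).
set l := strict_floor beta in l0 *.
have [dF _] := hF.
have cF : continuous F := @coef_continuous _ _ _ F j 0 dF l0.
have [M0 hM0] : exists M, forall x, Theta x -> `|F (x + 1 *: basis_vec j)| <= M.
  apply: (@continuous_bounded_on Theta (fun x => F (x + 1 *: basis_vec j))) => // y.
  have h : {for y, continuous (fun y : 'rV[R]_d => y + 1 *: basis_vec j)}.
    by apply: continuousD => //; exact: cst_continuous.
  exact: (@continuous_comp _ _ _ _ _ _ h (cF _)).
have /choice[Mk hMk] (k : 'I_l) : exists M, forall x, Theta x -> `|coef F j k x| <= M.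
  apply: continuous_bounded_on => //.
  exact: (@coef_continuous _ _ _ F j k dF (ltn_ord k)).
exists (l`!%:R * (M0 + L + \sum_(k < l) k`!%:R^-1 * Mk k)) => x xT.
have := holder_taylor x j 1 hF; rewrite -/l.
under eq_bigr do rewrite expr1n mulr1.
rewrite normr1 powR1 mulr1 big_ord_recr/=.
set S := \sum_(k < l) _; set c := coef F j l x.
have Sle : `|S| <= \sum_(k < l) k`!%:R^-1 * Mk k.
  apply: le_trans (ler_norm_sum _ _ _) _; apply: ler_sum => k _.
  by rewrite normrM ger0_norm ?invr_ge0// ler_wpM2l ?invr_ge0//; exact: hMk.
move=> h; have f0 : 0 < l`!%:R :> R by rewrite ltr0n fact_gt0.
rewrite -ler_pdivrMl//.
rewrite -[X in X * _](@ger0_norm _ (l`!%:R^-1)) ?invr_ge0// -normrM.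
have := hM0 x xT; move: h Sle; rewrite !ler_norml => /andP[? ?] /andP[? ?] /andP[? ?].
apply/andP; split; lra.
Qed.

Lemma mean_fun_differentiable n (f : 'I_n -> 'rV[R]_d -> R) :
  (forall i x, differentiable (f i) x) -> forall x, differentiable (mean_fun f) x.
Proof.
move=> df x; rewrite /mean_fun.
have -> : (fun z => n%:R^-1 * \sum_(i < n) f i z) = n%:R^-1 \*: (\sum_(i < n) f i).
  by apply/funext => z; rewrite /= fct_sumE.
by apply: differentiableZ; apply: differentiable_sum.
Qed.

Lemma gradient_mean_fun n (f : 'I_n -> 'rV[R]_d -> R) x :
  (forall i x, differentiable (f i) x) ->
  gradient (mean_fun f) x = n%:R^-1 *: \sum_(i < n) gradient (f i) x.
Proof.
move=> df; apply/rowP => j; rewrite gradient_coord mxE summxE.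
rewrite /pderiv /mean_fun.
have -> : (fun z => n%:R^-1 * \sum_(i < n) f i z) = n%:R^-1 \*: (\sum_(i < n) f i).
  by apply/funext => z; rewrite /= fct_sumE.
have dv i : derivable (f i) x (basis_vec j) by exact: diff_derivable.
rewrite deriveZ; last exact: derivable_sum.
rewrite derive_sum//; congr (_ * _).
by apply: eq_bigr => i _; rewrite gradient_coord.
Qed.

Lemma dotv_gradient_mean_fun n (f : 'I_n -> 'rV[R]_d -> R) x v :
  (forall i x, differentiable (f i) x) ->
  dotv (gradient (mean_fun f) x) v = n%:R^-1 * \sum_(i < n) dotv (gradient (f i) x) v.
Proof. by move=> df; rewrite gradient_mean_fun// dotvZl dotv_suml. Qed.

(** Add the strong convexity inequalities between 0 and a unit vector [e], taken in both directions:
    [alpha] is at most the increment of the gradient along [e], hence at most [Lbar]. *)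
Lemma strong_convexity_le_smoothness n (f : 'I_n -> 'rV[R]_d -> R) (alpha Lbar : R) :
  (0 < n)%N -> (0 < d)%N -> (forall i, two_smooth Lbar (f i)) ->
  strongly_convex alpha (mean_fun f) -> alpha <= Lbar.
Proof.
move=> n0 d0 sf [_ sc]; have df i y : differentiable (f i) y by case: (sf i).
pose e : 'rV[R]_d := basis_vec (Ordinal d0).
have := sc e 0; have := sc 0 e; rewrite !subr0 sub0r enormN enorm_basis expr1n mulr1.
rewrite dotvNr => h1 h2.
have : dotv (gradient (mean_fun f) e) e - dotv (gradient (mean_fun f) 0) e <= Lbar.
  rewrite !dotv_gradient_mean_fun// -mulrBr -sumrB.
  rewrite ler_pdivrMl ?ltr0n// mulr_natl -[X in _ *+ X]card_ord -sumr_const.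
  apply: ler_sum => i _; rewrite -dotvBl.
  apply: le_trans (le_trans (ler_norm _) (dotv_le _ _)) _.
  rewrite enorm_basis mulr1; have [_ /(_ e 0)] := sf i.
  by rewrite subr0 enorm_basis mulr1.
lra.
Qed.

End smooth_functions.

(** * One step of the algorithm *)

Section one_step.
Context {R : realType} {n d : nat}.
Hypotheses (n0 : (0 < n)%N) (d0 : (0 < d)%N).
Variables (Theta : set 'rV[R]_d) (f : 'I_n -> 'rV[R]_d -> R).
Variables (alpha Lbar G calK : R).
Hypotheses (Theta0 : Theta !=set0) (cTheta : compact Theta)
  (convTheta : convex_set Theta).
Hypothesis diamTheta : (ediam Theta <= calK%:E)%E.
Hypotheses (hG : 0 <= G) (hLbar : 0 <= Lbar).
Hypothesis f_smooth : forall i, two_smooth Lbar (f i).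
Hypothesis f_grad : forall i z, Theta z -> enorm (gradient (f i) z) <= G.
Hypothesis f_convex : strongly_convex alpha (mean_fun f).
Implicit Types (x g : 'I_n -> 'rV[R]_d) (z : 'rV[R]_d).

Lemma enorm_le_diam u v : Theta u -> Theta v -> enorm (u - v) <= calK.
Proof.
move=> uT vT; rewrite -lee_fin; apply: le_trans diamTheta.
by apply: ereal_sup_ubound; exists (u, v).
Qed.

Lemma calK_ge0 : 0 <= calK.
Proof.
case: Theta0 => u uT; apply: le_trans (enorm_le_diam uT uT); exact: enorm_ge0.
Qed.

Lemma avgv_in x : (forall i, Theta (x i)) -> Theta (avgv x).
Proof.
move=> xT; rewrite /avgv scaler_sumr; apply: convex_combination => //.
by rewrite sumr_const card_ord -[_ *+ n]mulr_natr mulVf// pnatr_eq0 -lt0n.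
Qed.

Definition sqdist x z : R := n%:R^-1 * \sum_i enorm (x i - z) ^+ 2.

Definition avgdot g x z : R := n%:R^-1 * \sum_i dotv (g i) (x i - z).

(** Convexity at the mean [m] involves the gradients at [m]; moving them to the points [x i] costs
    [G + Lbar * calK] times the dispersion. Replacing the squared distance of [m] to [z] by [sqdist]
    costs another [Lbar * calK / 2], whence the factor 3 / 2. *)
Lemma regret_le x z : (forall i, Theta (x i)) -> Theta z ->
  mean_fun f (avgv x) - mean_fun f z <=
  avgdot (fun i => gradient (f i) (x i)) x z - alpha / 2 * sqdist x z
  + (G + 3 / 2 * Lbar * calK) * dispersion x.
Proof.
move=> xT zT.
have df i y : differentiable (f i) y by case: (f_smooth i).
have mT := avgv_in xT; set m := avgv x in mT *.
have [_ /(_ z m)] := f_convex.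
rewrite -(opprB m z) dotvNr enormN dotv_gradient_mean_fun// => h.
have dK : dispersion x <= calK.
  by apply: dispersion_le => //; [move=> i j; exact: enorm_le_diam|exact: calK_ge0].
have d_ge0 := dispersion_ge0 x.
have aL : alpha <= Lbar := strong_convexity_le_smoothness n0 d0 f_smooth f_convex.
have n_ge0 : 0 <= n%:R^-1 :> R by rewrite invr_ge0.
have key : n%:R^-1 * \sum_i dotv (gradient (f i) m) (m - z) <=
    avgdot (fun i => gradient (f i) (x i)) x z + (G + Lbar * calK) * dispersion x.
  apply: (@le_trans _ _ (n%:R^-1 * \sum_i (dotv (gradient (f i) (x i)) (x i - z)
      + (G + Lbar * calK) * enorm (x i - m)))).
    rewrite ler_wpM2l//; apply: ler_sum => i _.
    (* The second term is bounded by the gradient bound [G], the third by smoothness and the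
       diameter. *)
    have -> : dotv (gradient (f i) m) (m - z) = dotv (gradient (f i) (x i)) (x i - z)
        - dotv (gradient (f i) (x i)) (x i - m)
        + dotv (gradient (f i) m - gradient (f i) (x i)) (m - z).
      by rewrite !(dotvBl, dotvBr); ring.
    rewrite -addrA lerD2l mulrDl; apply: lerD.
      rewrite -dotvNr; apply: le_trans (le_trans (ler_norm _) (dotv_le _ _)) _.
      by rewrite enormN ler_wpM2r ?enorm_ge0//; exact: f_grad.
    apply: le_trans (le_trans (ler_norm _) (dotv_le _ _)) _.
    rewrite mulrAC (enormBC (x i)); apply: ler_pM; rewrite ?enorm_ge0//.
      by case: (f_smooth i).
    exact: enorm_le_diam.
  rewrite big_split/= mulrDr lerD2l -mulr_sumr mulrCA.
  rewrite ler_wpM2l ?addr_ge0 ?mulr_ge0 ?calK_ge0//.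
  rewrite dispersionE; exact: avg_le_rms.
have S : sqdist x z = enorm (m - z) ^+ 2 + dispersion x ^+ 2 by exact: bias_variance.
rewrite S; set D := dispersion x in d_ge0 dK key *.
have K0 := calK_ge0.
(* As [alpha <= Lbar] and [D <= calK], the square of the dispersion lost here is
   absorbed by a term linear in [D]. *)
have : alpha * D ^+ 2 <= Lbar * calK * D.
  apply: (@le_trans _ _ (Lbar * D ^+ 2)); first by rewrite ler_wpM2r ?sqr_ge0.
  by rewrite -mulrA ler_wpM2l// expr2 ler_wpM2r.
move: h key; set E := enorm (m - z) ^+ 2; lra.
Qed.

Variable W : 'M[R]_n.
Hypothesis hW : doubly_stochastic W.
Let rho := spectral_norm
  (W - n%:R^-1 *: ((const_mx 1 : 'cV[R]_n) *m (const_mx 1 : 'cV[R]_n)^T)).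
Hypothesis rho1 : rho < 1.

Definition step eta x g : 'I_n -> 'rV[R]_d :=
  mix W (fun k => eproj Theta (x k - eta *: g k)).

Lemma step_in eta x g i : Theta (step eta x g i).
Proof.
have [W0 Wr _] := hW.
by apply: convex_combination => // k; exact: eproj_in.
Qed.

(** By [bias_variance], mixing can only decrease [sqdist], since it keeps the mean and shrinks the
    dispersion. Before mixing, [z] is its own projection, so nonexpansiveness applies and the square
    is expanded. *)
Lemma step_descent eta x g z : Theta z ->
  2 * eta * avgdot g x z <=
  sqdist x z - sqdist (step eta x g) z + eta ^+ 2 * (n%:R^-1 * \sum_i enorm (g i) ^+ 2).
Proof.
move=> zT; set y := fun k => eproj Theta (x k - eta *: g k).
have n_ge0 : 0 <= n%:R^-1 :> R by rewrite invr_ge0.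
have h1 : sqdist (step eta x g) z <= sqdist y z.
  rewrite /sqdist !bias_variance// avgv_mix// lerD2l.
  rewrite ler_pXn2r ?nnegrE ?dispersion_ge0//.
  apply: le_trans (dispersion_mix n0 hW y) _.
  by rewrite -[leRHS]mul1r ler_wpM2r ?dispersion_ge0// ltW.
have h2 : sqdist y z <= sqdist x z - 2 * eta * avgdot g x z
    + eta ^+ 2 * (n%:R^-1 * \sum_i enorm (g i) ^+ 2).
  have -> : sqdist x z - 2 * eta * avgdot g x z
      + eta ^+ 2 * (n%:R^-1 * \sum_i enorm (g i) ^+ 2) =
    n%:R^-1 * \sum_i (enorm (x i - z) ^+ 2 - 2 * (eta * dotv (g i) (x i - z))
      + eta ^+ 2 * enorm (g i) ^+ 2).
    by rewrite big_split sumrB/= -!mulr_sumr /sqdist /avgdot; ring.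
  rewrite /sqdist ler_wpM2l//; apply: ler_sum => i _.
  have -> : enorm (x i - z) ^+ 2 - 2 * (eta * dotv (g i) (x i - z))
      + eta ^+ 2 * enorm (g i) ^+ 2 = enorm (x i - eta *: g i - z) ^+ 2.
    rewrite [x i - _ - z]addrAC (sqr_enormB (x i - z)) dotvZr (dotvC (x i - z)) enormZ exprMn.
    by rewrite real_normK ?num_real.
  rewrite ler_pXn2r ?nnegrE ?enorm_ge0// /y.
  rewrite -{1}(eproj_id Theta0 cTheta zT).
  exact: eproj_nonexpansive.
lra.
Qed.

(** Each [x i] is its own projection, so the projected step moves it by at most [eta * enorm (g i)].
    Mixing comes after the step, hence [rho] multiplies the gradient term as well. *)
Lemma step_dispersion eta x g : 0 <= eta -> (forall i, Theta (x i)) ->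
  dispersion (step eta x g) <= rho * dispersion x + rho * (eta * rms g).
Proof.
move=> eta0 xT; set y := fun k => eproj Theta (x k - eta *: g k).
have n_ge0 : 0 <= n%:R^-1 :> R by rewrite invr_ge0.
have rho0 : 0 <= rho by exact: spectral_norm_ge0.
apply: le_trans (dispersion_mix n0 hW y) _.
rewrite -/rho -mulrDr ler_wpM2l//.
have -> : y = (fun i => x i + (y i - x i)) by apply/funext => i; rewrite subrKC.
apply: le_trans (dispersionD _ _) _; rewrite lerD2l.
apply: le_trans (dispersion_le_rms n0 _) _.
rewrite -(@ler_pXn2r _ 2) ?nnegrE ?mulr_ge0 ?rms_ge0//.
rewrite exprMn !sqr_rms mulrCA ler_wpM2l// mulr_sumr; apply: ler_sum => i _.
rewrite -exprMn ler_pXn2r ?nnegrE ?mulr_ge0 ?enorm_ge0//.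
rewrite -{1}(eproj_id Theta0 cTheta (xT i)).
apply: le_trans (eproj_nonexpansive Theta0 cTheta convTheta _ _) _.
by rewrite addrAC subrr add0r enormN enormZ ger0_norm.
Qed.

End one_step.

(** * The kernel gradient estimator *)

(* [g_sigma_algebraType] needs a pointed carrier, which a [measurableType] is not. *)
Definition pointed_at (T : choiceType) (t0 : T) : pointedType :=
  HB.pack T (isPointed.Build T t0).

Section sub_sigma_algebra.
Context {R : realType} {disp : measure_display} {T : measurableType disp}.
Variables (P : probability T R) (t0 : T) (S : set (set T)).

(** [T] with the coarser sigma-algebra generated by [S]: being determined by the past and the noise
    becomes an ordinary [measurable_fun], with its closure lemmas. *)
Definition sub_algebra := g_sigma_algebraType (S : set (set (pointed_at t0))).

HB.instance Definition _ := Measurable.on sub_algebra.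

Hypothesis S_measurable : <<s S >> `<=` measurable.

Lemma sub_algebra_measurable (Y : T -> R) :
  measurable_fun [set: sub_algebra] Y -> measurable_fun [set: T] Y.
Proof.
move=> mY _ B mB; rewrite setTI; apply: S_measurable.
by have := mY measurableT B mB; rewrite setTI.
Qed.

(** The substitute for conditioning on the past: an [S]-measurable factor separates from any
    integrable function of [r]. *)
Lemma mean_mul_noise (r : {RV P >-> R}) (Q : probability (measurableTypeR R) R)
    (Y : T -> R) (phi : R -> R) :
  (forall B : set R, measurable B -> distribution P r B = Q B) ->
  independent_of P r <<s S >> ->
  measurable_fun [set: sub_algebra] Y -> intg P Y -> intg Q phi ->
  intg P (fun w => Y w * phi (r w)) /\
  mean P (fun w => Y w * phi (r w)) = mean P Y * mean Q phi.
Proof.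
move=> rQ ind mY iY iphi.
have [ir <-] := intg_law rQ iphi.
apply: mean_mul_independent => // A B mA mB.
have mphi : measurable (phi @^-1` B : set R).
  by have := intg_measurable iphi measurableT mB; rewrite setTI.
have mYA : <<s S >> (Y @^-1` A).
  by have := mY measurableT A mA; rewrite setTI.
by rewrite setIC (ind _ _ mphi mYA) muleC.
Qed.

End sub_sigma_algebra.

(** * Second moment and bias of the estimator of one agent *)

Section estimator.
Context {R : realType} {disp : measure_display} {T : measurableType disp}.
Context {d : nat}.
Variables (P : probability T R) (t0 : T) (S : set (set T)).
Hypothesis S_measurable : <<s S >> `<=` measurable.
Variables (beta L Lbar G calK sigma : R) (K : R -> R).
Hypotheses (hbeta : 2 <= beta) (hL : 0 <= L) (hLbar : 0 <= Lbar) (hG : 0 <= G).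
Hypothesis hK : kernel_cond beta K.
Variables (Theta : set 'rV[R]_d) (F : 'rV[R]_d -> R).
Hypotheses (Theta0 : Theta !=set0) (cTheta : compact Theta).
Hypothesis diamTheta : forall u v, Theta u -> Theta v -> enorm (u - v) <= calK.
Hypothesis F_holder : holder_class beta L F.
Hypothesis F_smooth : two_smooth Lbar F.
Hypothesis F_grad : forall z, Theta z -> enorm (gradient F z) <= G.
Variables (r : {RV P >-> R}) (xi xi' : 'I_d -> {RV P >-> R}) (X : T -> 'rV[R]_d).
Variable h : R.
Hypotheses (h0 : 0 < h) (h1 : h <= 1).
Hypothesis r_law : forall B : set R, measurable B -> distribution P r B = uniformN11 B.
Hypothesis r_indep : independent_of P r <<s S >>.
Hypothesis X_in : forall w, Theta (X w).

Notation TS := (sub_algebra t0 S).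

Hypothesis mX : vmeasurable (X : TS -> 'rV[R]_d).
Hypothesis mxi : forall j, measurable_fun [set: TS] (xi j : TS -> R).
Hypothesis mxi' : forall j, measurable_fun [set: TS] (xi' j : TS -> R).
Hypothesis xi_var : forall j, ('E_P[fun w => (xi j w ^+ 2)%R] <= (sigma ^+ 2)%:E)%E.
Hypothesis xi'_var : forall j, ('E_P[fun w => (xi' j w ^+ 2)%R] <= (sigma ^+ 2)%:E)%E.

Notation U := (@uniformN11 R).
Notation l := (strict_floor beta).

Definition estimate (w : T) : 'rV[R]_d :=
  grad_estimator K F h (X w) (r w) (fun j => xi j w) (fun j => xi' j w).

Definition kappa : R := mean U (fun r => K r ^+ 2).
Definition kappa_beta : R := mean U (fun r => `|r| `^ beta * `|K r|).

Let mXT : vmeasurable X.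
Proof. by move=> j; apply: (sub_algebra_measurable S_measurable); exact: mX. Qed.

(** The floor is strict, yet [beta >= 2] still leaves [l >= 1]: the Taylor polynomial contains the
    linear term to be recovered. *)
Let l_gt0 : (0 < l)%N.
Proof.
have b0 : 0 < beta by apply: lt_le_trans hbeta.
have /andP[_] := strict_floorP b0.
by move=> /(le_trans hbeta); rewrite ler_nat.
Qed.

Let F_diff x : differentiable F x. Proof. by case: F_smooth. Qed.

Let cF : continuous F.
Proof. by move=> x; exact: differentiable_continuous. Qed.

Let mF (Y : T -> 'rV[R]_d) : vmeasurable Y -> measurable_fun [set: T] (fun w => F (Y w)).
Proof. exact: measurable_continuous_comp. Qed.

Lemma sqr_intg_noise (x : {RV P >-> R}) :
  ('E_P[fun w => (x w ^+ 2)%R] <= (sigma ^+ 2)%:E)%E ->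
  intg P (fun w => x w ^+ 2) /\ mean P (fun w => x w ^+ 2) <= sigma ^+ 2.
Proof.
move=> hx.
have ix : intg P (fun w => x w ^+ 2).
  apply/integrableP; split.
    by apply/measurable_EFinP; exact: measurable_funX.
  under eq_integral do rewrite /= ger0_norm ?sqr_ge0//.
  by move: hx; rewrite unlock => /le_lt_trans; apply; rewrite ltry.
by split => //; move: hx; rewrite (expectation_mean ix) lee_fin.
Qed.

Lemma noise_intg (x : {RV P >-> R}) :
  ('E_P[fun w => (x w ^+ 2)%R] <= (sigma ^+ 2)%:E)%E -> intg P x.
Proof.
move=> /sqr_intg_noise[ix _].
apply: (intg_dom _ (intgD (intg_cst P 1) ix)) => // w.
have := sqr_ge0 (`|x w| - 1); rewrite -(real_normK (num_real (x w))).
have := normr_ge0 (x w); nra.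
Qed.

Lemma measurable_estimate j : measurable_fun [set: T] (fun w => estimate w 0 j).
Proof.
rewrite /estimate /grad_estimator; under eq_fun do rewrite mxE.
have mK := kernel_measurable hK.
have mKr : measurable_fun [set: T] (fun w => K (r w)) by exact: (measurableT_comp mK).
apply: measurable_funM => //; apply: measurable_funM => //.
have mline (c : R) : vmeasurable (fun w => X w + (c * r w) *: basis_vec j).
  move=> i; under eq_fun do rewrite mxE [X in _ + X]mxE.
  apply: measurable_funD; first exact: mXT.
  by apply: measurable_funM => //; exact: measurable_funM.
apply: measurable_funB; apply: measurable_funD => //; apply: mF; first exact: mline.
have := mline (- h).
by under eq_fun do rewrite mulNr scaleNr.
Qed.

Let N : set T := r @^-1` outside_unit.

Let mN : measurable N.
Proof.
by have := @measurable_funPT _ _ _ _ r measurableT _ measurable_outside_unit; rewrite setTI.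
Qed.

Let PN : P N = 0%E.
Proof.
have := r_law measurable_outside_unit.
by rewrite uniform_outside_unit.
Qed.

Let r_le1 w : ~ N w -> `|r w| <= 1.
Proof. by move=> /contrapT /=; rewrite in_itv/= -ler_norml. Qed.

(** An [S]-measurable majorant of the squared difference quotient, so that its product with
    [K (r w) ^+ 2] factorises in the mean. The 3 comes from squaring a sum of three terms. *)
Let Y j (w : T) := 3 * ((G + Lbar) ^+ 2 + (4 * h ^+ 2)^-1 * (xi j w ^+ 2 + xi' j w ^+ 2)).

Let V := (G + Lbar) ^+ 2 + (2 * h ^+ 2)^-1 * sigma ^+ 2.

Let iY j : intg P (Y j) /\ mean P (Y j) <= 3 * V.
Proof.
have [i1 m1] := sqr_intg_noise (xi_var j); have [i2 m2] := sqr_intg_noise (xi'_var j).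
have i3 := intgZ (4 * h ^+ 2)^-1 (intgD i1 i2).
have i4 := intgD (intg_cst P ((G + Lbar) ^+ 2)) i3.
split; first exact: (intgZ 3 i4).
rewrite /Y meanZ// ler_wpM2l// meanD//; last exact: intg_cst.
rewrite mean_cst lerD2l meanZ; last exact: intgD.
rewrite meanD//.
have h2 : 0 < h ^+ 2 by rewrite exprn_gt0.
have -> : (2 * h ^+ 2)^-1 * sigma ^+ 2 = (4 * h ^+ 2)^-1 * (sigma ^+ 2 + sigma ^+ 2).
  by field; rewrite gt_eqF.
by rewrite ler_wpM2l ?lerD// invr_ge0 mulr_ge0// ltW.
Qed.

Let mY j : measurable_fun [set: TS] (Y j : TS -> R).
Proof.
apply: measurable_funM => //; apply: measurable_funD => //.
apply: measurable_funM => //; apply: measurable_funD; exact: measurable_funX.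
Qed.

Lemma estimate_coord_bound j w : `|r w| <= 1 ->
  estimate w 0 j ^+ 2 <= Y j w * K (r w) ^+ 2.
Proof.
move=> r1; rewrite mxE exprMn ler_wpM2r ?sqr_ge0//.
set x := X w; set D := F (x + (h * r w) *: basis_vec j) - F (x - (h * r w) *: basis_vec j).
have hD : `|D| <= 2 * h * (G + Lbar).
  apply: le_trans (central_difference _ _ _ hLbar F_smooth) _.
  have hr : `|h * r w| <= h by rewrite normrM gtr0_norm// ler_piMr// ltW.
  have hr1 : `|h * r w| <= 1 by exact: le_trans hr h1.
  apply: ler_pM.
  - by rewrite mulr_ge0.
  - by rewrite addr_ge0// mulr_ge0.
  - by rewrite ler_wpM2l.
  - apply: lerD.
      rewrite -gradient_coord; apply: le_trans (ler_coord_enorm _ _) _.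
      by apply: F_grad; exact: X_in.
    by rewrite ler_piMr.
have -> : F (x + (h * r w) *: basis_vec j) + xi j w -
    (F (x - (h * r w) *: basis_vec j) + xi' j w) = D + (xi j w - xi' j w).
  by rewrite /D; ring.
have {}hD : ((2 * h)^-1 * D) ^+ 2 <= (G + Lbar) ^+ 2.
  rewrite -[leLHS]real_normK ?num_real// ler_pXn2r ?nnegrE ?addr_ge0//.
  rewrite normrM gtr0_norm ?invr_gt0 ?mulr_gt0// ler_pdivrMl ?mulr_gt0//.
clearbody D; rewrite mulrDr mulrBr; set A := _ * D in hD *.
have -> : Y j w = 3 * ((G + Lbar) ^+ 2 + ((2 * h)^-1 * xi j w) ^+ 2 +
    ((2 * h)^-1 * xi' j w) ^+ 2).
  by rewrite /Y; field; rewrite gt_eqF.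
set b := _ * xi j w; set c := _ * xi' j w; move: hD.
(* These three squares add up to [3 * (A ^+ 2 + b ^+ 2 + c ^+ 2) - (A + b - c) ^+ 2]. *)
have := sqr_ge0 (A - b); have := sqr_ge0 (A + c); have := sqr_ge0 (b + c); nra.
Qed.

Lemma estimate_coord_sqr j : intg P (fun w => estimate w 0 j ^+ 2) /\
  mean P (fun w => estimate w 0 j ^+ 2) <= 3 * V * kappa.
Proof.
have [iYj mYj] := iY j.
have [iYK EYK] := mean_mul_noise r_law r_indep (mY j) iYj (kernel_sqr_intg hK).
have ie : intg P (fun w => estimate w 0 j ^+ 2).
  apply: (intg_ae_dom mN PN _ iYK).
    by apply: measurable_funX; exact: measurable_estimate.
  by move=> w /r_le1 /(estimate_coord_bound j); rewrite ger0_norm ?sqr_ge0.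
split=> //; apply: le_trans (le_mean_ae mN PN ie iYK _) _.
  by move=> w /r_le1 /(estimate_coord_bound j).
rewrite EYK ler_wpM2r// mean_ge0// => u; exact: sqr_ge0.
Qed.

Lemma estimate_sqr : intg P (fun w => enorm (estimate w) ^+ 2) /\
  mean P (fun w => enorm (estimate w) ^+ 2) <= d%:R * (3 * V * kappa).
Proof.
have E : (fun w => enorm (estimate w) ^+ 2) = (fun w => \sum_j estimate w 0 j ^+ 2).
  by apply/funext => w; rewrite enormE sqr_l2.
rewrite E; split.
  by apply: intg_sum => j _; case: (estimate_coord_sqr j).
rewrite mean_sum => [|j _]; last by case: (estimate_coord_sqr j).
rewrite -[d in d%:R]card_ord mulr_natl -sumr_const; apply: ler_sum => j _.
by case: (estimate_coord_sqr j).
Qed.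

Section coordinate.
Variables (z : 'rV[R]_d) (j : 'I_d).
Hypothesis zT : Theta z.

Let u w := X w 0 j - z 0 j.

Let u_le w : `|u w| <= calK.
Proof.
apply: le_trans (diamTheta (X_in w) zT).
by have := ler_coord_enorm (X w - z) j; rewrite !mxE.
Qed.

Let mu : measurable_fun [set: TS] (u : TS -> R).
Proof. by apply: measurable_funB => //; exact: mX. Qed.

Let muT : measurable_fun [set: T] u.
Proof. exact: (sub_algebra_measurable S_measurable mu). Qed.

Let iu : intg P u. Proof. exact: (intg_bounded P muT u_le). Qed.

(** The coefficient of [r ^+ k] in the difference quotient of the Taylor polynomial between [h * r]
    and [- h * r]; for [k = 1] it is the partial derivative itself. *)
Let a k w := (2 * h)^-1 * (h ^+ k - (- h) ^+ k) * (k`!%:R^-1 * coef F j k (X w)).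

Let F_times : times_differentiable l F. Proof. by case: F_holder. Qed.

Let ma k : (k <= l)%N -> measurable_fun [set: TS] (a k : TS -> R).
Proof.
move=> kl; apply: measurable_funM => //; apply: measurable_funM => //.
exact: (measurable_coef j F_times l_gt0 kl mX).
Qed.

Let iua k : (k <= l)%N -> intg P (fun w => u w * a k w).
Proof.
move=> kl; have [M hM] := coef_bounded j hL Theta0 cTheta l_gt0 F_holder kl.
have mua : measurable_fun [set: TS] (fun w : TS => u w * a k w).
  by apply: measurable_funM => //; exact: ma.
apply: (@intg_bounded _ _ _ P _
  (calK * (`|(2 * h)^-1 * (h ^+ k - (- h) ^+ k)| * (k`!%:R^-1 * M)))).
  exact: (sub_algebra_measurable S_measurable mua).
move=> w; rewrite normrM ler_pM// /a normrM ler_wpM2l// normrM.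
by rewrite ger0_norm ?invr_ge0// ler_wpM2l ?invr_ge0//; exact: hM.
Qed.

Let poly w := \sum_(k < l.+1) u w * a k w * (r w ^+ k * K (r w)).

(** The factor [r w ^+ 0] exhibits the zeroth moment of the kernel, which vanishes. *)
Let noise w := (2 * h)^-1 * u w * (xi j w - xi' j w) * (r w ^+ 0 * K (r w)).

Let iterm k : (k <= l)%N ->
  intg P (fun w => u w * a k w * (r w ^+ k * K (r w))) /\
  mean P (fun w => u w * a k w * (r w ^+ k * K (r w))) =
  mean P (fun w => u w * a k w) * mean U (fun r => r ^+ k * K r).
Proof.
move=> kl; apply: (mean_mul_noise r_law r_indep (Y := fun w => u w * a k w) _ (iua kl)
  (kernel_monomial_intg hK k)).
by apply: measurable_funM => //; exact: ma.
Qed.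

Let poly_mean : intg P poly /\ mean P poly = mean P (fun w => pderiv j F (X w) * u w).
Proof.
split; first by apply: intg_sum => k _; have [] := iterm (ltn_ord k : k <= l)%N.
rewrite mean_sum => [|k _]; last by have [] := iterm (ltn_ord k : k <= l)%N.
have l1 : (1 < l.+1)%N by [].
rewrite (bigD1 (Ordinal l1))//= big1 ?addr0 => [|k k1].
  have [_ ->] := iterm (l_gt0 : 1 <= l)%N.
  under [X in _ * mean _ X]eq_fun do rewrite expr1.
  rewrite (kernel_moment1 hK) mulr1; congr mean; apply/funext => w.
  rewrite /a /= invr1 mul1r !expr1 opprK mulrC; congr (_ * _).
  by rewrite -mulr2n -[h *+ 2]mulr_natl mulVf ?mul1r// mulf_neq0// gt_eqF.
have [_ ->] := iterm (ltn_ord k : k <= l)%N.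
(* Every remaining index is 0 or between 2 and [l], the range of vanishing moments. *)
rewrite (kernel_moment hK) ?mulr0//.
have kl : (k <= l)%N by rewrite -ltnS ltn_ord.
rewrite kl andbT; move: k1; rewrite -val_eqE/=.
by case: (val k) => [|[|]].
Qed.

Let noise_mean : intg P noise /\ mean P noise = 0.
Proof.
have mD : measurable_fun [set: TS] (fun w : TS => (2 * h)^-1 * u w * (xi j w - xi' j w)).
  by apply: measurable_funM; [exact: measurable_funM|exact: measurable_funB].
have iD : intg P (fun w => (2 * h)^-1 * u w * (xi j w - xi' j w)).
  have iN := intg_norm (intgB (noise_intg (xi_var j)) (noise_intg (xi'_var j))).
  apply: (intg_dom _ (intgZ ((2 * h)^-1 * calK) iN)).
    exact: (sub_algebra_measurable S_measurable mD).
  move=> w; rewrite normrM ler_wpM2r// normrM ger0_norm ?ler_wpM2l//.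
    by rewrite invr_ge0 mulr_ge0// ltW.
  by rewrite invr_ge0 mulr_ge0// ltW.
have [i ->] := mean_mul_noise r_law r_indep mD iD (kernel_monomial_intg hK 0).
by rewrite (kernel_moment hK)// mulr0.
Qed.

Let rem w := u w * estimate w 0 j - poly w - noise w.

(** What is left is the difference of the Taylor remainders at [s] and [- s], each at most
    [L * |s| ^ beta]; dividing by [2 * h] lowers the exponent of [h] by one. *)
Let rem_le w : `|rem w| <= L * h `^ (beta - 1) * (`|u w| * (`|r w| `^ beta * `|K (r w)|)).
Proof.
pose s := h * r w.
pose ta (b : R) := \sum_(k < l.+1) k`!%:R^-1 * coef F j k (X w) * b ^+ k.
have E : rem w = u w * ((2 * h)^-1 * ((F (X w + s *: basis_vec j) - ta s) -
   (F (X w + (- s) *: basis_vec j) - ta (- s))) * K (r w)).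
  rewrite /rem; have -> : poly w = u w * ((2 * h)^-1 * (ta s - ta (- s)) * K (r w)).
    rewrite /poly /ta -sumrB mulr_sumr mulr_suml mulr_sumr; apply: eq_bigr => k _.
    rewrite /a /s -[- (h * r w)]mulNr !exprMn; move: (h ^+ k) ((- h) ^+ k) (r w ^+ k) => p q v.
    by ring.
  by rewrite /noise /estimate /grad_estimator mxE -/s scaleNr expr0; ring.
rewrite E normrM mulrCA ler_wpM2l// normrM mulrA ler_wpM2r// normrM.
have h2 : 0 < 2 * h by rewrite mulr_gt0.
rewrite gtr0_norm ?invr_gt0// ler_pdivrMl//.
apply: le_trans (ler_normB _ _) _.
have hp := holder_taylor (X w) j s F_holder; have hm := holder_taylor (X w) j (- s) F_holder.
apply: le_trans (lerD hp hm) _.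
rewrite normrN /s normrM gtr0_norm// powRM ?(ltW h0)//.
have -> : h `^ beta = h * h `^ (beta - 1).
  have <- : h `^ (1 + (beta - 1)) = h * h `^ (beta - 1).
    by rewrite [LHS]powRD ?(gt_eqF h0) ?implybT// powRr1// ltW.
  by rewrite addrC subrK.
by rewrite le_eqVlt; apply/orP; left; apply/eqP; ring.
Qed.

Let iue : intg P (fun w => estimate w 0 j * u w).
Proof.
have [ie _] := estimate_coord_sqr j.
apply: (intg_dom _ (intgZ calK (intgD (intg_cst P 1) ie))).
  apply: measurable_funM => //; exact: measurable_estimate.
move=> w; rewrite normrM mulrC ler_pM//.
have := sqr_ge0 (`|estimate w 0 j| - 1); rewrite -(real_normK (num_real (estimate w 0 j))).
have := normr_ge0 (estimate w 0 j); nra.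
Qed.

(** [u] is determined by the state, so the mean of the remainder bound splits into [kappa_beta] and
    the mean of [|u|]. Keeping [|u|], rather than bounding it by [calK], lets strong convexity
    absorb it. *)
Lemma estimate_coord_bias :
  [/\ intg P (fun w => estimate w 0 j * u w),
      intg P (fun w => pderiv j F (X w) * u w) &
      mean P (fun w => pderiv j F (X w) * u w) <=
      mean P (fun w => estimate w 0 j * u w) +
      L * kappa_beta * h `^ (beta - 1) * mean P (fun w => `|u w|)].
Proof.
have iua1 : intg P (fun w => pderiv j F (X w) * u w).
  have [M hM] := coef_bounded j hL Theta0 cTheta l_gt0 F_holder l_gt0.
  have mp : measurable_fun [set: TS] (fun w : TS => pderiv j F (X w)).
    exact: (measurable_coef j F_times l_gt0 l_gt0 mX).
  apply: (@intg_bounded _ _ _ P _ (M * calK)).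
    by apply: (sub_algebra_measurable (t0 := t0) S_measurable); exact: measurable_funM.
  by move=> w; rewrite normrM ler_pM//; exact: hM.
split => //.
have [ip Ep] := poly_mean; have [ino Eno] := noise_mean.
have iue' : intg P (fun w => u w * estimate w 0 j).
  by move: iue; under eq_fun do rewrite mulrC.
have irem : intg P rem by exact: (intgB (intgB iue' ip) ino).
have [iuk Euk] := mean_mul_noise r_law r_indep
  (measurableT_comp (@normr_measurable _ _) mu :
    measurable_fun [set: TS] (fun w : TS => `|u w|))
  (intg_norm iu) (kernel_abs_intg hK).
have : - mean P rem <= L * kappa_beta * h `^ (beta - 1) * mean P (fun w => `|u w|).
  have -> : L * kappa_beta * h `^ (beta - 1) * mean P (fun w => `|u w|) =
     mean P (fun w => L * h `^ (beta - 1) * (`|u w| * (`|r w| `^ beta * `|K (r w)|))).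
    by rewrite meanZ// Euk /kappa_beta; ring.
  rewrite -[- mean P rem]mulN1r -meanZ//; apply: le_mean; first exact: intgZ.
    exact: intgZ.
  by move=> w; apply: le_trans (rem_le w); rewrite mulN1r -normrN ler_norm.
have -> : mean P rem = mean P (fun w => u w * estimate w 0 j) - mean P poly - mean P noise.
  by rewrite /rem meanB ?meanB//; exact: intgB.
rewrite Ep Eno.
have -> : mean P (fun w => u w * estimate w 0 j) = mean P (fun w => estimate w 0 j * u w).
  by congr mean; apply/funext => w; rewrite mulrC.
lra.
Qed.

Lemma coord_intg : intg P u.
Proof. exact: iu. Qed.

Lemma coord_sqr_intg : intg P (fun w => u w ^+ 2).
Proof.
apply: (@intg_bounded _ _ _ P _ (calK ^+ 2)); first exact: measurable_funX.
by move=> w; rewrite normrX ler_pXn2r ?nnegrE// (le_trans _ (u_le w)).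
Qed.

End coordinate.

Lemma estimate_bias z (alpha : R) : Theta z -> 0 < alpha ->
  [/\ intg P (fun w => dotv (estimate w) (X w - z)),
      intg P (fun w => dotv (gradient F (X w)) (X w - z)),
      intg P (fun w => enorm (X w - z) ^+ 2) &
      mean P (fun w => dotv (gradient F (X w)) (X w - z)) <=
      mean P (fun w => dotv (estimate w) (X w - z)) +
      alpha / 4 * mean P (fun w => enorm (X w - z) ^+ 2) +
      d%:R * ((L * kappa_beta * h `^ (beta - 1)) ^+ 2 / alpha)].
Proof.
move=> zT al0; set B := L * kappa_beta * h `^ (beta - 1).
have E1 : (fun w => dotv (estimate w) (X w - z)) =
    (fun w => \sum_j estimate w 0 j * (X w 0 j - z 0 j)).
  by apply/funext => w; apply: eq_bigr => j _; rewrite [(X w - z) 0 j]mxE [X in _ + X]mxE.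
have E2 : (fun w => dotv (gradient F (X w)) (X w - z)) =
    (fun w => \sum_j pderiv j F (X w) * (X w 0 j - z 0 j)).
  apply/funext => w; apply: eq_bigr => j _.
  by rewrite gradient_coord [(X w - z) 0 j]mxE [X in _ + X]mxE.
have E3 : (fun w => enorm (X w - z) ^+ 2) = (fun w => \sum_j (X w 0 j - z 0 j) ^+ 2).
  apply/funext => w; rewrite enormE sqr_l2; apply: eq_bigr => j _.
  by rewrite [(X w - z) 0 j]mxE [X in _ + X]mxE.
rewrite E1 E2 E3.
have i1 j : intg P (fun w => estimate w 0 j * (X w 0 j - z 0 j)).
  by have [] := estimate_coord_bias j zT.
have i2 j : intg P (fun w => pderiv j F (X w) * (X w 0 j - z 0 j)).
  by have [] := estimate_coord_bias j zT.
have i3 j := coord_sqr_intg j zT.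
split; [by apply: intg_sum => j _..|].
have -> : d%:R * (B ^+ 2 / alpha) = \sum_(j < d) B ^+ 2 / alpha.
  by rewrite sumr_const card_ord mulr_natl.
rewrite !mean_sum// mulr_sumr -!big_split/=.
apply: ler_sum => j _; have [_ _] := estimate_coord_bias j zT.
move=> /le_trans; apply; rewrite -/B -addrA lerD2l.
have iu := intg_norm (coord_intg j zT).
rewrite -meanZ// -meanZ//; rewrite -[X in _ + X](mean_cst P (B ^+ 2 / alpha)).
rewrite -meanD; [|exact: intgZ|exact: intg_cst].
apply: le_mean; [exact: intgZ|by apply: intgD; [exact: intgZ|exact: intg_cst]|].
move=> w; set v := _ - _; rewrite -(real_normK (num_real v)).
(* Young's inequality by completing the square, in each coordinate; summing the [B ^+ 2 / alpha]
   produces the factor [d]. *)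
have -> : alpha / 4 * `|v| ^+ 2 + B ^+ 2 / alpha =
    B * `|v| + (alpha * `|v| / 2 - B) ^+ 2 / alpha.
  by field; rewrite gt_eqF.
by rewrite lerDl divr_ge0 ?sqr_ge0// ltW.
Qed.

End estimator.

(** * Summation over time *)

Section sums.
Context {R : realType}.

(** The concave power lies below its tangent at 1; this is Young's inequality for [y ^ a] and 1 with
    exponents [1 / a] and [1 / (1 - a)]. *)
Lemma powR_tangent (a y : R) : 0 < a < 1 -> 0 <= y -> y `^ a <= 1 + a * (y - 1).
Proof.
move=> /andP[a0 a1] y0.
have q0 : 0 < (1 - a)^-1 by rewrite invr_gt0 subr_gt0.
have p0 : 0 < a^-1 by rewrite invr_gt0.
have := @conjugate_powR R (y `^ a) 1 a^-1 (1 - a)^-1 (powR_ge0 _ _) ler01 p0 q0.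
rewrite !invrK addrC subrK => /(_ erefl).
rewrite -powRrM divff ?gt_eqF// powRr1// powR1 mulr1; lra.
Qed.

Lemma sum_powR_le (a : R) (m : nat) : 0 < a < 1 ->
  \sum_(1 <= t < m.+1) t%:R `^ (a - 1) <= a^-1 * m%:R `^ a.
Proof.
move=> a01; have /andP[a0 a1] := a01.
elim: m => [|m IH]; first by rewrite big_geq// powR0 ?mulr0// gt_eqF.
rewrite big_nat_recr//=.
have s0 : 0 < m.+1%:R :> R by rewrite ltr0n.
have h := powR_tangent a01 (divr_ge0 (ler0n R m) (ltW s0)).
have sa : 0 < m.+1%:R `^ a :> R by rewrite powR_gt0.
have E : m%:R `^ a = (m%:R / m.+1%:R) `^ a * m.+1%:R `^ a :> R.
  by rewrite -powRM ?divr_ge0 ?ler0n// divfK ?gt_eqF.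
have E1 : m.+1%:R `^ (a - 1) = m.+1%:R `^ a / m.+1%:R :> R.
  by rewrite powRB ?(gt_eqF s0) ?implybT// powRr1 ?ler0n.
(* The tangent inequality at [m / (m + 1)], scaled by [(m + 1) ^ a]; it makes the sum telescope. *)
have h2 : m%:R `^ a <= m.+1%:R `^ a - a * m.+1%:R `^ (a - 1).
  rewrite {1}E E1; apply: le_trans (ler_wpM2r (ltW sa) h) _.
  rewrite le_eqVlt; apply/orP; left; apply/eqP.
  move: s0; rewrite -(natr1 m) => s0; field; rewrite gt_eqF//.
apply: le_trans (lerD IH (lexx _)) _.
rewrite -(@ler_pM2l _ a)// mulrDr !mulrA !mulfV ?gt_eqF// !mul1r; lra.
Qed.

(** By induction, with [ln (1 + x) <= x] at [x = - 1 / (m + 2)]. *)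
Lemma harmonic_le_ln (m : nat) : (0 < m)%N ->
  \sum_(1 <= t < m.+1) t%:R^-1 <= ln m%:R + 1 :> R.
Proof.
case: m => // m _; elim: m => [|m IH].
  by rewrite big_nat1 invr1 ln1 add0r.
rewrite big_nat_recr//=; apply: le_trans (lerD IH (lexx _)) _.
rewrite addrAC lerD2r.
have s0 : 0 < m.+1%:R :> R by rewrite ltr0n.
have s1 : 0 < m.+2%:R :> R by rewrite ltr0n.
rewrite -lerBrDl -lerN2 opprB -ln_div ?posrE//.
have -> : m.+1%:R / m.+2%:R = 1 + (- m.+2%:R^-1) :> R.
  by rewrite -[X in X / _](addrK 1) natr1 mulrBl divff ?gt_eqF// mul1r.
by apply: le_ln1Dx; rewrite ltrN2 invf_lt1// ltr1n.
Qed.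

(** The deterministic core, to be used with [a = 1 / beta] and [D = d]: [Rg] is the mean regret, [A]
    the mean squared distance, [De] the mean dispersion and [V] the mean squared norm of the
    estimators. *)
Lemma regret_sum_le (alpha a rho C D Cv Lk : R) (Rg A De V : nat -> R) (m : nat) :
  0 < alpha -> 0 < a < 1 -> 0 <= rho < 1 -> 0 <= C -> 0 <= D -> (0 < m)%N ->
  (forall t, 0 <= A t) -> (forall t, 0 <= De t) -> De 1%N = 0 ->
  (forall t, (0 < t)%N -> V t <= D * Cv * t%:R `^ a) ->
  (forall t, (0 < t)%N ->
     Rg t <= alpha * t%:R / 4 * (A t - A t.+1) + (alpha * t%:R)^-1 * V t
             - alpha / 4 * A t + D * Lk / alpha * t%:R `^ (a - 1) + C * De t) ->
  (forall t, (0 < t)%N ->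
     De t.+1 <= rho * De t + (alpha * t%:R)^-1 * (rho ^+ 2 * V t + 1)) ->
  0 <= Cv -> 0 <= Lk ->
  \sum_(1 <= t < m.+1) Rg t <=
    D / alpha * m%:R `^ a * (a^-1 * (Cv + Lk) + C * Cv * a^-1 * rho ^+ 2 / (1 - rho))
    + C / (alpha * (1 - rho)) * (ln m%:R + 1).
Proof.
move=> al0 a01 /andP[rho0 rho1] C0 D0 m0 A0 De0 De1 hV hR hD Cv0 Lk0.
have r1 : 0 < 1 - rho by rewrite subr_gt0.
pose S := \sum_(1 <= t < m.+1) t%:R `^ (a - 1).
pose H : R := \sum_(1 <= t < m.+1) t%:R^-1.
have hS : S <= a^-1 * m%:R `^ a by exact: sum_powR_le.
have hH : H <= ln m%:R + 1 by exact: harmonic_le_ln.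
have Vt t : (0 < t)%N -> (alpha * t%:R)^-1 * V t <= D * Cv / alpha * t%:R `^ (a - 1).
  move=> t0; have t0' : 0 < t%:R :> R by rewrite ltr0n.
  rewrite powRB ?(gt_eqF t0') ?implybT// powRr1 ?ler0n//.
  rewrite ler_pdivrMl ?mulr_gt0//; apply: le_trans (hV t t0) _.
  by rewrite le_eqVlt; apply/orP; left; apply/eqP; field; rewrite !gt_eqF.
have hDe : (1 - rho) * \sum_(1 <= t < m.+1) De t <=
    rho ^+ 2 * (D * Cv / alpha) * S + alpha^-1 * H.
  (* Keeping [De k.+1] on the left makes the recursion inductive: adding the next [(1 - rho) * De]
     leaves room for exactly [rho * De]. *)
  have : forall k, (1 - rho) * \sum_(1 <= t < k.+1) De t + De k.+1 <=
      rho ^+ 2 * (D * Cv / alpha) * (\sum_(1 <= t < k.+1) t%:R `^ (a - 1)) +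
      alpha^-1 * (\sum_(1 <= t < k.+1) t%:R^-1).
    elim=> [|k IH]; first by rewrite !big_geq// De1 !mulr0 !addr0.
    rewrite !(@big_nat_recr _ _ _ k.+1)//=.
    have h1 := hD k.+1 isT; have h2 := Vt k.+1 isT.
    have h3 : (alpha * k.+1%:R)^-1 * (rho ^+ 2 * V k.+1 + 1) <=
       rho ^+ 2 * (D * Cv / alpha) * k.+1%:R `^ (a - 1) + alpha^-1 * k.+1%:R^-1.
      rewrite mulrDr mulr1 invfM lerD2r mulrCA -invfM -[leRHS]mulrA.
      by rewrite ler_wpM2l ?sqr_ge0.
    have := le_trans h1 (lerD (lexx _) h3); move: IH; clear h1 h2 h3.
    move: (De k.+2) (De k.+1) (k.+1%:R `^ (a - 1)) (k.+1%:R^-1 : R) => u v p q.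
    move: (\sum_(1 <= t < k.+1) De t) (\sum_(1 <= t < k.+1) _) => s1 s2.
    move: (\sum_(1 <= t < k.+1) _) (alpha^-1) (D * Cv / alpha) => s3 al c.
    lra.
  by move=> /(_ m); apply: le_trans; rewrite lerDl.
have hRg : \sum_(1 <= t < m.+1) Rg t <= (D * Cv / alpha + D * Lk / alpha) * S
    + C * \sum_(1 <= t < m.+1) De t.
  (* The potential [alpha * k / 4 * A k.+1] is what the telescoping leaves; it is zero at [k = 0]
     and is dropped at the end by its sign. *)
  have : forall k, \sum_(1 <= t < k.+1) Rg t + alpha * k%:R / 4 * A k.+1 <=
      (D * Cv / alpha + D * Lk / alpha) * (\sum_(1 <= t < k.+1) t%:R `^ (a - 1))
      + C * \sum_(1 <= t < k.+1) De t.
    elim=> [|k IH]; first by rewrite !big_geq// !mulr0 !mul0r !addr0.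
    rewrite !(@big_nat_recr _ _ _ k.+1)//=.
    have h1 := hR k.+1 isT; have h2 := Vt k.+1 isT.
    have h3 := le_trans h1 (lerD (lerD (lerB (lerD (lexx _) h2) (lexx _)) (lexx _)) (lexx _)).
    move: h3 IH; rewrite -(natr1 k); clear h1 h2.
    move: (Rg k.+1) (A k.+1) (A k.+2) (De k.+1) => rg u u' v.
    move: (k%:R : R) ((k%:R + 1) `^ (a - 1)) => kR p.
    move: (\sum_(1 <= t < k.+1) Rg t) (\sum_(1 <= t < k.+1) De t) => s1 s2.
    move: (\sum_(1 <= t < k.+1) _) => s3.
    move: (D * Cv / alpha) (D * Lk / alpha) => c1 c2.
    lra.
  have q0 : 0 <= alpha * m%:R / 4 by rewrite divr_ge0// mulr_ge0 ?ler0n// ltW.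
  by move=> /(_ m); apply: le_trans; rewrite lerDl mulr_ge0.
apply: le_trans hRg _.
have hDe2 : \sum_(1 <= t < m.+1) De t <=
    (1 - rho)^-1 * (rho ^+ 2 * (D * Cv / alpha) * S + alpha^-1 * H).
  by rewrite -ler_pdivrMl ?invrK// invr_gt0.
apply: (@le_trans _ _ ((D * Cv / alpha + D * Lk / alpha) * (a^-1 * m%:R `^ a) +
   C * ((1 - rho)^-1 * (rho ^+ 2 * (D * Cv / alpha) * (a^-1 * m%:R `^ a) +
   alpha^-1 * (ln m%:R + 1))))).
  have ai0 : 0 <= alpha^-1 by rewrite invr_ge0 ltW.
  apply: lerD.
    by rewrite ler_wpM2l// addr_ge0// !mulr_ge0.
  rewrite ler_wpM2l//; apply: le_trans hDe2 _.
  rewrite ler_wpM2l ?invr_ge0 ?(ltW r1)//; apply: lerD; rewrite ler_wpM2l//.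
  by rewrite !mulr_ge0// sqr_ge0.
have /andP[a0 _] := a01.
by rewrite le_eqVlt; apply/orP; left; apply/eqP; field; rewrite !gt_eqF.
Qed.

End sums.

(** * The regret *)

Section vmeasurable_theory.
Context {R : realType} {disp : measure_display} {T : measurableType disp} {d : nat}.
Implicit Types X Y : T -> 'rV[R]_d.

Lemma vmeasurable_cst (v : 'rV[R]_d) : vmeasurable (fun _ : T => v).
Proof. by move=> j; exact: measurable_cst. Qed.

Lemma vmeasurableB X Y : vmeasurable X -> vmeasurable Y ->
  vmeasurable (fun w => X w - Y w).
Proof.
move=> mX mY j; under eq_fun do rewrite mxE [X in _ + X]mxE.
exact: measurable_funB.
Qed.

Lemma vmeasurableZ c X : vmeasurable X -> vmeasurable (fun w => c *: X w).
Proof.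
by move=> mX j; under eq_fun do rewrite mxE; exact: measurable_funM.
Qed.

Lemma vmeasurable_sum (I : Type) (s : seq I) (X : I -> T -> 'rV[R]_d) :
  (forall i, vmeasurable (X i)) -> vmeasurable (fun w => \sum_(i <- s) X i w).
Proof.
move=> mX j; under eq_fun do rewrite summxE.
by apply: measurable_sum => i; exact: mX.
Qed.

Lemma measurable_enorm X : vmeasurable X -> measurable_fun [set: T] (fun w => enorm (X w)).
Proof. exact: measurable_continuous_comp (@enorm_continuous R d). Qed.

(** A nonexpansive map is continuous, so each coordinate of the projection is. *)
Lemma vmeasurable_eproj (Theta : set 'rV[R]_d) X : Theta !=set0 -> compact Theta ->
  convex_set Theta -> vmeasurable X -> vmeasurable (fun w => eproj Theta (X w)).
Proof.
move=> T0 cT convT mX j.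
apply: (@measurable_continuous_comp _ _ _ _ (fun v => eproj Theta v 0 j)) => // v.
apply/(@cvgrPdist_le _ _ _ (nbhs v) (nbhs_filter v)) => e e0.
have sh : {for v, continuous (fun u : 'rV[R]_d => enorm (v - u))}.
  have h1 : {for v, continuous (fun u : 'rV[R]_d => v - u)}.
    by apply: continuousB; [exact: cst_continuous|].
  exact: (@continuous_comp _ _ _ _ _ _ h1 (@enorm_continuous R d _)).
have /(@cvgrPdist_le _ _ _ (nbhs v) (nbhs_filter v)) /(_ e e0) := sh.
apply: filterS => u; rewrite subrr enorm0 sub0r normrN ger0_norm ?enorm_ge0// => hu.
have := ler_coord_enorm (eproj Theta v - eproj Theta u) j.
rewrite mxE [X in _ + X]mxE => /le_trans; apply.
exact: le_trans (eproj_nonexpansive T0 cT convT _ _) hu.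
Qed.

Lemma sigma_generated_sub (I : Type) (Z : I -> T -> R) :
  (forall i, measurable_fun [set: T] (Z i)) -> sigma_generated Z `<=` measurable.
Proof.
move=> mZ; apply: smallest_sub; first exact: sigma_algebra_measurable.
by move=> _ [i _ [B mB <-]]; exact: mZ.
Qed.

Lemma sigma_generated_measurable (I : Type) (Z : I -> T -> R) (t0 : T)
    (S : set (set T)) (i : I) : sigma_generated Z `<=` S ->
  measurable_fun [set: sub_algebra t0 S] (Z i : sub_algebra t0 S -> R).
Proof.
move=> ZS _ B mB; apply: sub_sigma_algebra; apply: ZS; apply: sub_sigma_algebra.
by exists i => //; exists B.
Qed.

End vmeasurable_theory.

Section process.
Context {R : realType} {disp : measure_display} {T : measurableType disp}.
Context {n d : nat}.
Hypotheses (n0 : (0 < n)%N) (d0 : (0 < d)%N).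
Variables (P : probability T R) (t0 : T).
Variables (beta L Lbar sigma G calK alpha : R) (K : R -> R).
Hypotheses (hbeta : 2 <= beta) (hL : 0 <= L) (hLbar : 0 <= Lbar) (hG : 0 <= G).
Hypothesis hK : kernel_cond beta K.
Hypothesis alpha0 : 0 < alpha.
Variables (Theta : set 'rV[R]_d) (f : 'I_n -> 'rV[R]_d -> R) (W : 'M[R]_n).
Hypotheses (Theta0 : Theta !=set0) (convTheta : convex_set Theta) (cTheta : compact Theta).
Hypothesis diamTheta : (ediam Theta <= calK%:E)%E.
Hypothesis f_holder : forall i, holder_class beta L (f i).
Hypothesis f_smooth : forall i, two_smooth Lbar (f i).
Hypothesis f_grad : forall i z, Theta z -> enorm (gradient (f i) z) <= G.
Hypothesis f_convex : strongly_convex alpha (mean_fun f).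
Hypothesis hW : doubly_stochastic W.
Let rho := spectral_norm
  (W - n%:R^-1 *: ((const_mx 1 : 'cV[R]_n) *m (const_mx 1 : 'cV[R]_n)^T)).
Hypothesis rho1 : rho < 1.
Variables (r : 'I_n -> nat -> {RV P >-> R}) (xi xi' : 'I_n -> nat -> 'I_d -> {RV P >-> R})
  (x : 'I_n -> nat -> T -> 'rV[R]_d).
Let eta (t : nat) : R := 2 / (alpha * t%:R).
Let h (t : nat) : R := t%:R `^ (- (2 * beta)^-1).
Hypothesis x_iter : zero_order_iterates Theta f W K eta h (fun i t => r i t)
    (fun i t j => xi i t j) (fun i t j => xi' i t j) x.
Hypothesis x_noise : noise_cond sigma r xi xi' x.

Let X t w := fun i : 'I_n => x i t w.

Let g t w : 'I_n -> 'rV[R]_d := fun k =>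
  estimate K (f k) (r k t) (xi k t) (xi' k t) (x k t) (h t) w.

Let X_step t w : (0 < t)%N -> X t.+1 w = step Theta W (eta t) (X t w) (g t w).
Proof. by move=> t1; apply/funext => i; case: x_iter => _; exact. Qed.

Let X_in t w i : (0 < t)%N -> Theta (x i t w).
Proof.
case: t => // -[_|t _].
  by case: x_iter => -[x1 x1T x1E] _; rewrite x1E.
have := X_step w (isT : 0 < t.+1)%N => /(congr1 (fun F => F i)); rewrite /X => ->.
exact: (step_in Theta0 cTheta convTheta hW).
Qed.

Let S i t : set (set T) :=
  noise_algebra (fun i t j => xi i t j) (fun i t j => xi' i t j) i t `|` state_algebra x t.

Let S_measurable i t : (forall k, vmeasurable (x k t)) -> <<s S i t >> `<=` measurable.
Proof.
move=> mx; apply: smallest_sub; first exact: sigma_algebra_measurable.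
move=> A [|]; apply: sigma_generated_sub.
  by move=> [j []] /=.
by move=> [k j] /=; exact: mx.
Qed.

Let x_sub i t k : vmeasurable (x k t : sub_algebra t0 (S i t) -> 'rV[R]_d).
Proof.
move=> j; apply: (@sigma_generated_measurable _ _ _ _
  (fun (ik : 'I_n * 'I_d) w => x ik.1 t w 0 ik.2) _ _ (k, j)).
exact: subsetUr.
Qed.

Let xi_sub i t j : measurable_fun [set: sub_algebra t0 (S i t)]
  (xi i t j : sub_algebra t0 (S i t) -> R).
Proof.
apply: (@sigma_generated_measurable _ _ _ _
  (fun jb : 'I_d * bool => (if jb.2 then (fun i t j => xi i t j : T -> R)
    else (fun i t j => xi' i t j : T -> R)) i t jb.1) _ _ (j, true)).
exact: subsetUl.
Qed.

Let xi'_sub i t j : measurable_fun [set: sub_algebra t0 (S i t)]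
  (xi' i t j : sub_algebra t0 (S i t) -> R).
Proof.
apply: (@sigma_generated_measurable _ _ _ _
  (fun jb : 'I_d * bool => (if jb.2 then (fun i t j => xi i t j : T -> R)
    else (fun i t j => xi' i t j : T -> R)) i t jb.1) _ _ (j, false)).
exact: subsetUl.
Qed.

(** The iterates are plain functions, so measurability is proved along the recursion: it is what
    places [S i t] inside the measurable sets, on which the measurability of the estimators, hence
    of the next iterates, relies. *)
Let x_measurable t : (0 < t)%N -> forall i, vmeasurable (x i t).
Proof.
elim: t => // -[_ _ i|t IH _ i].
  case: x_iter => -[x1 _ x1E] _; rewrite (_ : x i 1%N = fun=> x1).
    exact: vmeasurable_cst.
  by apply/funext => w; rewrite x1E.
have mx := IH isT.
have -> : x i t.+2 = fun w => \sum_(k < n) W i k *: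
    eproj Theta (x k t.+1 w - eta t.+1 *: g t.+1 w k).
  apply/funext => w.
  by have := X_step w (isT : 0 < t.+1)%N => /(congr1 (fun F => F i)).
apply: vmeasurable_sum => k; apply: vmeasurableZ; apply: vmeasurable_eproj => //.
apply: vmeasurableB => //; apply: vmeasurableZ => j.
exact: (measurable_estimate (S_measurable (i := k) mx) hK (f_smooth k) (r k t.+1)
  (xi k t.+1) (xi' k t.+1) (h t.+1) (@x_sub k t.+1 k) j).
Qed.

Let h_gt0 t : (0 < t)%N -> 0 < h t.
Proof. by move=> t0'; rewrite powR_gt0// ltr0n. Qed.

Let beta_gt0 : 0 < beta. Proof. exact: lt_le_trans hbeta. Qed.

Let h_le1 t : (0 < t)%N -> h t <= 1.
Proof.
move=> t1; rewrite /h powRN invf_le1; last by rewrite powR_gt0// ltr0n.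
rewrite -[leLHS](powRr0 (t%:R : R)); apply: ler_powR; first by rewrite ler1n.
by rewrite invr_ge0 mulr_ge0// ltW.
Qed.

Let diam u v : Theta u -> Theta v -> enorm (u - v) <= calK.
Proof. exact: enorm_le_diam diamTheta _ _. Qed.

Let kappa_ge0 : 0 <= kappa K.
Proof. by apply: mean_ge0 => u; exact: sqr_ge0. Qed.

Let h_inv_sqr t : (0 < t)%N -> (h t ^+ 2)^-1 = t%:R `^ beta^-1.
Proof.
move=> t1; rewrite /h powRN -exprVn invrK -powR_mulrn ?powR_ge0// -powRrM.
by congr (_ `^ _); field; rewrite gt_eqF.
Qed.

Let h_bias t : (0 < t)%N -> (h t `^ (beta - 1)) ^+ 2 = t%:R `^ (beta^-1 - 1).
Proof.
move=> t1; rewrite -powR_mulrn ?powR_ge0// /h -!powRrM.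
by congr (_ `^ _); field; rewrite gt_eqF.
Qed.

(** As [h t <= 1], the part of the second moment without [h] is also at most a multiple of
    [h ^ (-2)], so one constant covers both parts. *)
Definition variance_const : R := 3 * ((G + Lbar) ^+ 2 + sigma ^+ 2) * kappa K.

Definition consensus_const : R := G + 3 / 2 * Lbar * calK.

Let agent_variance t k : (0 < t)%N ->
  intg P (fun w => enorm (g t w k) ^+ 2) /\
  mean P (fun w => enorm (g t w k) ^+ 2) <= d%:R * variance_const * t%:R `^ beta^-1.
Proof.
move=> t1; have [rl ri v1 v2] := x_noise k t1.
have [i1 m1] := @estimate_sqr _ _ _ _ P t0 _
  (S_measurable (i := k) (x_measurable t1)) _ _ _ _ _
  hLbar hG hK _ _ (f_smooth k) (f_grad k) (r k t) (xi k t) (xi' k t) (x k t) (h t)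
  (h_gt0 t1) (h_le1 t1) rl ri (fun w => X_in w k t1)
  (@x_sub k t k) (@xi_sub k t) (@xi'_sub k t) v1 v2.
split; first exact: i1.
apply: le_trans m1 _; rewrite -[leRHS]mulrA ler_wpM2l// /variance_const.
rewrite -h_inv_sqr// [leRHS]mulrAC ler_wpM2r// -[leRHS]mulrA ler_wpM2l//.
have h2 : 0 < h t ^+ 2 by rewrite exprn_gt0// h_gt0.
rewrite [leRHS]mulrDl; apply: lerD.
  by rewrite ler_peMr ?sqr_ge0// invf_ge1// exprn_ile1 ?h_le1// ltW// h_gt0.
rewrite mulrC ler_wpM2l ?sqr_ge0// lef_pV2 ?posrE ?mulr_gt0 ?h_gt0//.
by rewrite ler_peMl ?ler1n// ltW.
Qed.

Let agent_bias t k z : (0 < t)%N -> Theta z ->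
  [/\ intg P (fun w => dotv (g t w k) (x k t w - z)),
      intg P (fun w => dotv (gradient (f k) (x k t w)) (x k t w - z)),
      intg P (fun w => enorm (x k t w - z) ^+ 2) &
      mean P (fun w => dotv (gradient (f k) (x k t w)) (x k t w - z)) <=
      mean P (fun w => dotv (g t w k) (x k t w - z)) +
      alpha / 4 * mean P (fun w => enorm (x k t w - z) ^+ 2) +
      d%:R * (L * kappa_beta beta K) ^+ 2 / alpha * t%:R `^ (beta^-1 - 1)].
Proof.
move=> t1 zT; have [rl ri v1 v2] := x_noise k t1.
have [i1 i2 i3 m1] := @estimate_bias _ _ _ _ P t0 _
  (S_measurable (i := k) (x_measurable t1)) _ _ _ _ _ _ _
  hbeta hL hLbar hG hK _ _ Theta0 cTheta diam (f_holder k)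
  (f_smooth k) (f_grad k) (r k t) (xi k t) (xi' k t) (x k t) (h t)
  (h_gt0 t1) (h_le1 t1) rl ri (fun w => X_in w k t1)
  (@x_sub k t k) (@xi_sub k t) (@xi'_sub k t) v1 v2 z alpha zT alpha0.
split; [exact: i1|exact: i2|exact: i3|].
apply: le_trans m1 _; rewrite lerD2l exprMn h_bias//.
by rewrite le_eqVlt; apply/orP; left; apply/eqP; rewrite !mulrA mulrAC.
Qed.

Let intg_avg (Y : 'I_n -> T -> R) : (forall k, intg P (Y k)) ->
  intg P (fun w => n%:R^-1 * \sum_k Y k w).
Proof. by move=> iY; apply: intgZ; apply: intg_sum => k _; exact: iY. Qed.

Let mean_avg (Y : 'I_n -> T -> R) : (forall k, intg P (Y k)) ->
  mean P (fun w => n%:R^-1 * \sum_k Y k w) = n%:R^-1 * \sum_k mean P (Y k).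
Proof.
move=> iY; rewrite meanZ; last by apply: intg_sum => k _; exact: iY.
by rewrite mean_sum// => k _; exact: iY.
Qed.

Let avg_cst (c : R) : n%:R^-1 * \sum_(k < n) c = c.
Proof.
by rewrite sumr_const card_ord -[X in _ * X]mulr_natl mulKf// pnatr_eq0 -lt0n.
Qed.

Let ninv_ge0 : 0 <= n%:R^-1 :> R. Proof. by rewrite invr_ge0. Qed.

Let calK0 : 0 <= calK := calK_ge0 Theta0 diamTheta.

Let mean_x_measurable t : (0 < t)%N -> vmeasurable (mean_iterate x t).
Proof.
move=> t1; apply: vmeasurableZ; apply: vmeasurable_sum => k; exact: x_measurable.
Qed.

Let mean_f_continuous : continuous (mean_fun f).
Proof.
move=> v; apply: differentiable_continuous; apply: mean_fun_differentiable => i y.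
by case: (f_smooth i).
Qed.

Lemma regret_intg t z : (0 < t)%N ->
  intg P (fun w => mean_fun f (mean_iterate x t w) - mean_fun f z).
Proof.
move=> t1; apply: intgB; last exact: intg_cst.
have [M hM] := continuous_bounded_on Theta0 cTheta mean_f_continuous.
apply: (@intg_bounded _ _ _ P _ M).
  exact: (measurable_continuous_comp mean_f_continuous (mean_x_measurable t1)).
move=> w; apply: hM; apply: (avgv_in n0 Theta0 cTheta convTheta) => k.
exact: X_in.
Qed.

Let dispersion_intg t : (0 < t)%N -> intg P (fun w => dispersion (X t w)).
Proof.
move=> t1; apply: (@intg_bounded _ _ _ P _ calK).
  rewrite /dispersion; apply: (@measurableT_comp _ _ _ _ _ _ (@Num.sqrt R)).
    by apply: continuous_measurable_fun; exact: sqrt_continuous.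
  apply: measurable_funM => //; apply: measurable_sum => k.
  apply: measurable_funX; apply: measurable_enorm; apply: vmeasurableB.
    exact: x_measurable.
  exact: mean_x_measurable.
move=> w; rewrite ger0_norm ?dispersion_ge0//; apply: dispersion_le => // i j.
by apply: diam; exact: X_in.
Qed.

Lemma regret_bound (T0 : nat) z : (0 < T0)%N -> Theta z ->
  \sum_(1 <= t < T0.+1) mean P (fun w => mean_fun f (mean_iterate x t w) - mean_fun f z) <=
  d%:R / alpha * T0%:R `^ beta^-1 *
    (beta * (variance_const + (L * kappa_beta beta K) ^+ 2) +
     consensus_const * variance_const * beta * rho ^+ 2 / (1 - rho)) +
  consensus_const / (alpha * (1 - rho)) * (ln T0%:R + 1).
Proof.
move=> T0_gt0 zT.
pose V t := mean P (fun w => n%:R^-1 * \sum_k enorm (g t w k) ^+ 2).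
pose A t := mean P (fun w => sqdist (X t w) z).
pose De t := mean P (fun w => dispersion (X t w)).
have rho0 : 0 <= rho by exact: spectral_norm_ge0.
have iA t : (0 < t)%N -> intg P (fun w => sqdist (X t w) z).
  by move=> t1; apply: intg_avg => k; have [] := agent_bias k t1 zT.
have iV t : (0 < t)%N -> intg P (fun w => n%:R^-1 * \sum_k enorm (g t w k) ^+ 2).
  by move=> t1; apply: intg_avg => k; have [] := agent_variance k t1.
have cV0 : 0 <= variance_const.
  by rewrite /variance_const !mulr_ge0// addr_ge0// sqr_ge0.
have C0 : 0 <= consensus_const by rewrite addr_ge0// !mulr_ge0.
(* [beta] is written as the inverse of [a = beta^-1] to match the summation bound. *)
rewrite -[X in X * (variance_const + _)](invrK beta) -[X in _ * X * rho ^+ 2](invrK beta).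
apply: (@regret_sum_le R alpha beta^-1 rho consensus_const d%:R variance_const
  ((L * kappa_beta beta K) ^+ 2) _ A De V) => //.
- rewrite invr_gt0 beta_gt0 invf_lt1//.
  by apply: lt_le_trans hbeta; rewrite ltr1n.
- by rewrite rho0 rho1.
- move=> t; apply: mean_ge0 => w; rewrite mulr_ge0// sumr_ge0// => k _.
  exact: sqr_ge0.
- by move=> t; apply: mean_ge0 => w; exact: dispersion_ge0.
(* All agents start at the same point, so the initial dispersion is zero. *)
- rewrite /De -[RHS](mean_cst P 0); congr mean; apply/funext => w.
  case: x_iter => -[x1 _ x1E] _; apply: le_anti; rewrite dispersion_ge0 andbT.
  by apply: dispersion_le => // i j; rewrite /X !x1E subrr enorm0.
- move=> t t1; rewrite /V mean_avg => [|k]; last by have [] := agent_variance k t1.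
  rewrite -[leRHS]avg_cst ler_wpM2l//; apply: ler_sum => k _.
  by have [] := agent_variance k t1.
- move=> t t1.
  pose gr w := fun k => gradient (f k) (x k t w).
  have ig : intg P (fun w => avgdot (g t w) (X t w) z).
    by apply: intg_avg => k; have [] := agent_bias k t1 zT.
  have igr : intg P (fun w => avgdot (gr w) (X t w) z).
    by apply: intg_avg => k; have [] := agent_bias k t1 zT.
  have E1 : mean P (fun w => avgdot (gr w) (X t w) z) <=
      mean P (fun w => avgdot (g t w) (X t w) z) + alpha / 4 * A t
      + d%:R * (L * kappa_beta beta K) ^+ 2 / alpha * t%:R `^ (beta^-1 - 1).
    rewrite /A /avgdot /sqdist !mean_avg => [|k|k|k]; try by have [] := agent_bias k t1 zT.
    rewrite -[X in _ <= _ + X]avg_cst mulrCA -!mulrDr ler_wpM2l// mulr_sumr -!big_split/=.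
    by apply: ler_sum => k _; have [] := agent_bias k t1 zT.
  have E2 : mean P (fun w => mean_fun f (mean_iterate x t w) - mean_fun f z) <=
      mean P (fun w => avgdot (gr w) (X t w) z) - alpha / 2 * A t + consensus_const * De t.
    have iD := dispersion_intg t1.
    rewrite /A /De -!meanZ//; last exact: iA.
    rewrite -meanB//; last by apply: intgZ; exact: iA.
    rewrite -meanD; [|by apply: intgB => //; apply: intgZ; exact: iA|exact: intgZ].
    apply: le_mean; first exact: regret_intg.
      by apply: intgD; [apply: intgB => //; apply: intgZ; exact: iA|exact: intgZ].
    move=> w; apply: (regret_le n0 d0 Theta0 cTheta convTheta diamTheta hG hLbar
      f_smooth f_grad f_convex) => // k.
    exact: X_in.
  have E3 : mean P (fun w => avgdot (g t w) (X t w) z) <=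
      alpha * t%:R / 4 * (A t - A t.+1) + (alpha * t%:R)^-1 * V t.
    rewrite /A /V -meanB; [|exact: iA..].
    rewrite -meanZ; last by apply: intgB; exact: iA.
    rewrite -meanZ; last exact: iV.
    rewrite -meanD; last 2 first.
    + by apply: intgZ; apply: intgB; exact: iA.
    + by apply: intgZ; exact: iV.
    apply: le_mean => //.
      by apply: intgD; apply: intgZ; [apply: intgB; exact: iA|exact: iV].
    move=> w.
    have := step_descent n0 Theta0 cTheta convTheta hW rho1 (eta t) (X t w) (g t w) zT.
    rewrite -X_step//.
    have at0 : 0 < alpha * t%:R by rewrite mulr_gt0// ltr0n.
    have e0 : 0 < 2 * eta t by rewrite mulr_gt0// divr_gt0.
    (* Division by [2 * eta t] turns the two coefficients into [alpha * t / 4] and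
       [eta t / 2 = 1 / (alpha * t)]. *)
    rewrite -ler_pdivlMl// => /le_trans; apply.
    rewrite le_eqVlt; apply/orP; left; apply/eqP; rewrite /eta; field.
    by rewrite (gt_eqF alpha0) !pnatr_eq0 -!lt0n n0 t1.
  move: E1 E2 E3; lra.
- move=> t t1.
  have iD := dispersion_intg t1.
  rewrite /De /V -meanZ// -[X in _ * (_ + X)](mean_cst P 1).
  rewrite -meanZ; last exact: iV.
  rewrite -meanD; [|by apply: intgZ; exact: iV|exact: intg_cst].
  rewrite -meanZ; last by apply: intgD; [apply: intgZ; exact: iV|exact: intg_cst].
  rewrite -meanD; last 2 first.
  + exact: intgZ.
  + by apply: intgZ; apply: intgD; [apply: intgZ; exact: iV|exact: intg_cst].
  apply: le_mean; first exact: dispersion_intg.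
    apply: intgD; first exact: intgZ.
    by apply: intgZ; apply: intgD; [apply: intgZ; exact: iV|exact: intg_cst].
  move=> w; rewrite X_step//.
  have at0 : 0 < alpha * t%:R by rewrite mulr_gt0// ltr0n.
  have e0 : 0 <= eta t by rewrite divr_ge0// ltW.
  have xT k : Theta (X t w k) by exact: X_in.
  apply: le_trans (step_dispersion n0 Theta0 cTheta convTheta hW (g t w) e0 xT) _.
  rewrite -/rho lerD2l -sqr_rms// /eta mulrA mulrC.
  rewrite -subr_ge0.
  set q := rms _.
  have -> : (alpha * t%:R)^-1 * (rho ^+ 2 * q ^+ 2 + 1) - q * (rho * (2 / (alpha * t%:R)))
     = (alpha * t%:R)^-1 * (rho * q - 1) ^+ 2.
    by field; rewrite (gt_eqF alpha0) pnatr_eq0 -lt0n t1.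
  by rewrite mulr_ge0 ?sqr_ge0// invr_ge0 ltW.
- exact: sqr_ge0.
Qed.

(** Jensen's inequality, obtained pathwise from the gradient inequality at the averaged point: the
    linear terms average to zero and the quadratic ones have the right sign. *)
Lemma averaged_regret_bound (T0 : nat) z : (0 < T0)%N -> Theta z ->
  intg P (fun w => mean_fun f (averaged_estimator x T0 w) - mean_fun f z) /\
  mean P (fun w => mean_fun f (averaged_estimator x T0 w) - mean_fun f z) <=
  T0%:R^-1 * \sum_(1 <= t < T0.+1)
    mean P (fun w => mean_fun f (mean_iterate x t w) - mean_fun f z).
Proof.
move=> T1 zT.
have T0gt : 0 < T0%:R :> R by rewrite ltr0n.
have cst_sum (c : R) : T0%:R^-1 * \sum_(1 <= t < T0.+1) c = c.
  by rewrite sumr_const_nat subn1 /= -[X in _ * X]mulr_natl mulKf// gt_eqF.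
have jensen (w : T) : mean_fun f (averaged_estimator x T0 w) - mean_fun f z <=
    T0%:R^-1 * \sum_(1 <= t < T0.+1) (mean_fun f (mean_iterate x t w) - mean_fun f z).
  set y := averaged_estimator x T0 w.
  have E : T0%:R^-1 * \sum_(1 <= t < T0.+1)
      dotv (gradient (mean_fun f) y) (mean_iterate x t w - y) = 0.
    rewrite -dotv_sumr -dotvZr sumrB scalerBr -/(averaged_estimator x T0 w) -/y.
    rewrite sumr_const_nat subn1/= -[y *+ T0]scaler_nat scalerA mulVf ?gt_eqF// scale1r subrr.
    by rewrite dotvC -(scale0r (0 : 'rV[R]_d)) dotvZl mul0r.
  rewrite -[leLHS]addr0 -[X in _ + X]E -[X in X + _]cst_sum -mulrDr -big_split/=.
  rewrite ler_wpM2l ?invr_ge0//; apply: ler_sum => t _.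
  have [_ /(_ (mean_iterate x t w) y)] := f_convex.
  have : 0 <= alpha / 2 * enorm (mean_iterate x t w - y) ^+ 2.
    by rewrite mulr_ge0 ?sqr_ge0// divr_ge0// ltW.
  lra.
have yT w : Theta (averaged_estimator x T0 w).
  rewrite /averaged_estimator big_add1 big_mkord/= scaler_sumr.
  apply: (convex_combination Theta0 cTheta convTheta) => [i||i].
  - by rewrite invr_ge0.
  - by rewrite sumr_const card_ord -[_ *+ T0]mulr_natr mulVf// gt_eqF.
  - by apply: (avgv_in n0 Theta0 cTheta convTheta) => k; exact: X_in.
have iy : intg P (fun w => mean_fun f (averaged_estimator x T0 w) - mean_fun f z).
  apply: intgB; last exact: intg_cst.
  have [M hM] := continuous_bounded_on Theta0 cTheta mean_f_continuous.
  apply: (@intg_bounded _ _ _ P _ M); last by move=> w; exact: hM.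
  apply: (measurable_continuous_comp mean_f_continuous).
  rewrite /averaged_estimator; apply: vmeasurableZ => j.
  under eq_fun do rewrite big_add1 big_mkord.
  by apply: vmeasurable_sum => t; exact: mean_x_measurable.
split=> //.
have iR t : intg P (fun w => mean_fun f (mean_iterate x t.+1 w) - mean_fun f z).
  exact: regret_intg.
rewrite big_add1 big_mkord -mean_sum => [|t _]; last exact: iR.
rewrite -meanZ; last by apply: intg_sum => t _; exact: iR.
apply: le_mean => //; first by apply: intgZ; apply: intg_sum => t _; exact: iR.
by move=> w; have := jensen w; rewrite big_add1 big_mkord.
Qed.

End process.

(** * The constants and the two bounds *)

Unset Implicit Arguments.
Theorem theorem4 (R : realType) (beta L Lbar sigma G calK : R) (K : R -> R)
    (hbeta : 2 <= beta) (hL : 0 < L) (hLbar : 0 < Lbar) (hsigma : 0 <= sigma)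
    (hG : 0 < G) (hcalK : 0 < calK) (hK : kernel_cond beta K) :
  exists B1 B2 B3 : R, [/\ 0 < B1, 0 < B2, 0 < B3 &
  forall (n d T0 : nat) (alpha : R) (Theta : set 'rV[R]_d)
    (f : 'I_n -> 'rV[R]_d -> R) (W : 'M[R]_n)
    (disp : measure_display) (T : measurableType disp) (P : probability T R)
    (r : 'I_n -> nat -> {RV P >-> R})
    (xi xi' : 'I_n -> nat -> 'I_d -> {RV P >-> R})
    (x : 'I_n -> nat -> T -> 'rV[R]_d),
  let rho := spectral_norm
    (W - n%:R^-1 *: ((const_mx 1 : 'cV[R]_n) *m (const_mx 1 : 'cV[R]_n)^T)) in
  let eta := fun t : nat => 2 / (alpha * t%:R) in
  let h := fun t : nat => t%:R `^ (- (2 * beta)^-1) in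
  let fbar := mean_fun f in
  (1 <= n)%N -> (1 <= d)%N -> (1 <= T0)%N -> 0 < alpha ->
  Theta !=set0 -> convex_set Theta -> compact Theta ->
  (ediam Theta <= calK%:E)%E ->
  (forall i, holder_class beta L (f i)) ->
  (forall i, two_smooth Lbar (f i)) ->
  (forall i z, Theta z -> enorm (gradient (f i) z) <= G) ->
  strongly_convex alpha fbar ->
  W^T = W -> doubly_stochastic W -> rho < 1 ->
  zero_order_iterates Theta f W K eta h (fun i t => r i t)
    (fun i t j => xi i t j) (fun i t j => xi' i t j) x ->
  noise_cond sigma r xi xi' x ->
  (forall z : 'rV[R]_d, Theta z ->
    (\sum_(1 <= t < T0.+1) 'E_P[fun w => (fbar (mean_iterate x t w) - fbar z)%R]
     <= (d%:R / alpha * T0%:R `^ (beta^-1) * (B1 + B2 * rho ^+ 2 / (1 - rho))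
         + B3 / (alpha * (1 - rho)) * (ln T0%:R + 1))%:E)%E) /\
  (forall xstar : 'rV[R]_d, Theta xstar ->
    (forall z, Theta z -> fbar xstar <= fbar z) ->
    ('E_P[fun w => (fbar (averaged_estimator x T0 w) - fbar xstar)%R]
     <= (d%:R / alpha * T0%:R `^ (- ((beta - 1) / beta))
           * (B1 + B2 * rho ^+ 2 / (1 - rho))
         + B3 / (alpha * (1 - rho)) * ((ln T0%:R + 1) / T0%:R))%:E)%E)].
Proof.
pose Cv := variance_const Lbar sigma G K.
pose Lk := (L * kappa_beta beta K) ^+ 2.
pose C := consensus_const Lbar G calK.
have b0 : 0 < beta by apply: lt_le_trans hbeta.
have Cv0 : 0 <= Cv.
  rewrite /Cv /variance_const mulr_ge0//; last first.
    by apply: mean_ge0 => u; exact: sqr_ge0.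
  by rewrite mulr_ge0// addr_ge0 ?sqr_ge0.
have Lk0 : 0 <= Lk by exact: sqr_ge0.
have C0 : 0 < C by rewrite /C /consensus_const ltr_wpDr// !mulr_ge0// ltW.
(* [Cv] and [Lk] are only shown to be nonnegative, so 1 is added to make the first two constants
   positive; [C] is positive because [G] is. *)
exists (beta * (Cv + Lk) + 1), (C * Cv * beta + 1), C; split => //.
- by rewrite ltr_wpDl// mulr_ge0 ?addr_ge0// ltW.
- by rewrite ltr_wpDl// (mulr_ge0 (mulr_ge0 (ltW C0) Cv0) (ltW b0)).
move=> n d T0 alpha Theta f W disp T P r xi xi' x rho eta h fbar n0 d0 T00 al0 Th0 convT
  cT diamT fH fS fG fC _ hW rho1 x_iter x_noise.
(* A space of total mass one is nonempty; this provides the point that [sub_algebra] requires. *)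
have [t0 _] : [set: T] !=set0.
  apply/set0P/negP => /eqP E; have := @probability_setT _ _ _ P.
  by rewrite E measure0 => /esym/eqP; rewrite onee_eq0.
have rho0 : 0 <= rho by exact: spectral_norm_ge0.
have bound z : Theta z ->
    \sum_(1 <= t < T0.+1) mean P (fun w => fbar (mean_iterate x t w) - fbar z) <=
    d%:R / alpha * T0%:R `^ beta^-1 *
      (beta * (Cv + Lk) + 1 + (C * Cv * beta + 1) * rho ^+ 2 / (1 - rho))
    + C / (alpha * (1 - rho)) * (ln T0%:R + 1).
  move=> zT.
  have := regret_bound n0 d0 t0 hbeta (ltW hL) (ltW hLbar) (ltW hG) hK al0 Th0 convT cT
    diamT fH fS fG fC hW rho1 x_iter x_noise T00 zT.
  move=> /le_trans; apply; rewrite lerD2r; apply: ler_wpM2l.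
    by rewrite mulr_ge0 ?powR_ge0// divr_ge0// ltW.
  have q0 : 0 <= rho ^+ 2 / (1 - rho).
    by rewrite divr_ge0 ?sqr_ge0// subr_ge0 ltW.
  rewrite -/Cv -/Lk -/C -!(mulrA _ (rho ^+ 2)).
  move: q0; set q := rho ^+ 2 / _; lra.
have T0gt : 0 < T0%:R :> R by rewrite ltr0n.
split=> [z zT|z zT _].
  (* The condition [1 <= t] is kept in the sum because integrability holds from time 1 on. *)
  rewrite big_nat_cond.
  rewrite (eq_bigr (fun t => (mean P (fun w => fbar (mean_iterate x t w) - fbar z))%:E)).
    by rewrite -big_nat_cond sumEFin lee_fin; exact: bound.
  move=> t /andP[/andP[t1 _] _]; rewrite expectation_mean//.
  exact: (regret_intg n0 t0 hK Th0 convT cT fS hW x_iter z t1).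
have [iy hy] := averaged_regret_bound n0 t0 hK al0 Th0 convT cT fS fC hW x_iter T00 zT.
rewrite expectation_mean// lee_fin; apply: le_trans hy _.
have hT : 0 <= T0%:R^-1 :> R by rewrite invr_ge0 ltW.
apply: le_trans (ler_wpM2l hT (bound z zT)) _.
(* The exponent equals [beta^-1 - 1]: the averaged bound is the cumulative one divided by [T0]. *)
have -> : T0%:R `^ (- ((beta - 1) / beta)) = T0%:R^-1 * T0%:R `^ beta^-1 :> R.
  rewrite -[T0%:R^-1]powR_inv1 ?ltW// -powRD ?(gt_eqF T0gt) ?implybT//.
  by congr (_ `^ _); field; rewrite gt_eqF.
by rewrite le_eqVlt; apply/orP; left; apply/eqP; field; rewrite ?gt_eqF// subr_gt0.
Qed.
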